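(* For every fixed $k\ge3$ and every $0<\eta<1/2$ there is a constant $C_{\eta,k}$ such that the central clause window of random $k$-SAT satisfies, for all sufficiently large $n$, $$W_{\eta,k}(n)\le C_{\eta,k}\,\frac{n}{\log n}.$$
   Context: Random $k$-SAT: over $n$ Boolean variables there are $N_{n,k}=2^k\binom nk$ possible $k$-clauses (disjunctions of $k$ literals on $k$ distinct variables; each clause is determined by a $k$-set $S\subseteq[n]$ and the unique pattern $a\in\{0,1\}^S$ that falsifies it). Each clause is included independently with probability $p$; write $\mu_p$ for the resulting product measure. For $0<\alpha<1$, $p_\alpha=p_\alpha(n)$ is the infimum of $p\in[0,1]$ such that the random formula is unsatisfiable with $\mu_p$-probability at least $\alpha$. The central clause window is $W_{\eta,k}(n)=N_{n,k}(p_{1-\eta}-p_\eta)$. *)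

(* Defs.v *)
From mathcomp Require Import all_boot all_order all_algebra.
From mathcomp Require Import all_classical all_reals all_analysis.
Set Implicit Arguments.
Unset Strict Implicit.
Unset Printing Implicit Defensive.
Import Order.TTheory GRing.Theory Num.Theory.
Local Open Scope ring_scope.

Section RandomSat.
Variables n k : nat.

(* The pair (S, a), with S a k-set of variables and a in {0,1}^S the unique
   pattern falsifying the clause, is encoded as a partial function: c i is
   Some (a i) if i is in S, and None otherwise. *)
Definition clause :=
  {c : {ffun 'I_n -> option bool} | #|[set i | c i != None]| == k}.

Definition formula := {set clause}.

Definition assignment := {ffun 'I_n -> bool}.

Definition falsifies (x : assignment) (c : clause) : bool :=
  [forall i, if val c i is Some b then x i == b else true].

Definition satisfiable (F : formula) : bool :=
  [exists x : assignment, [forall c in F, ~~ falsifies x c]].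

Definition num_clauses : nat := (2 ^ k * 'C(n, k))%N.

Lemma card_clause : #|{: clause}| = num_clauses.
Proof.
rewrite card_sig /num_clauses -sum1_card.
rewrite (partition_big
  (fun c : {ffun 'I_n -> option bool} => [set i | c i != None])
  (fun S : {set 'I_n} => #|S| == k)) //=.
transitivity (\sum_(S : {set 'I_n} | #|S| == k) 2 ^ k)%N; last first.
  rewrite sum_nat_const mulnC; congr (_ * _)%N.
  by have := card_draws 'I_n k; rewrite card_ord cardsE => ->.
apply: eq_bigr => S /eqP cardS.
transitivity
  #|pffun_on (None : option bool) (mem S) (predC1 (None : option bool))|;
  last first.
  rewrite card_pffun_on cardS; congr (_ ^ _)%N.
  by rewrite cardC1 card_option card_bool.
rewrite -sum1_card; apply: eq_bigl => c.
apply/andP/pffun_onP => [[_ /eqP <-]|[/fintype.subsetP sub im]].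
  split; first by apply/fintype.subsetP => i; rewrite !inE.
  by move=> y /mapP[i]; rewrite mem_enum inE => ci ->; rewrite inE.
suff E : [set i | c i != None] = S.
  by rewrite E; split; [rewrite unfold_in /= E cardS|].
apply/setP => i; rewrite inE; apply/idP/idP => [ci|iS].
  by apply: sub; rewrite inE.
by apply: im; apply: fintype.image_f.
Qed.

Variable R : realType.

Definition mu (p : R) (E : {set formula}) : R :=
  \sum_(F in E) \prod_(c : clause) (if c \in F then p else 1 - p).

Definition unsat_event : {set formula} := [set F | ~~ satisfiable F].

Definition p_alpha (alpha : R) : R :=
  inf [set p : R | 0 <= p <= 1 /\ alpha <= mu p unsat_event]%classic.

Definition clause_window (eta : R) : R :=
  num_clauses%:R * (p_alpha (1 - eta) - p_alpha eta).

End RandomSat.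

(* Main.v *)
Require Import Defs.
From mathcomp Require Import all_boot all_order all_algebra perm.
From mathcomp Require Import ring lra zify.
Set Implicit Arguments.
Unset Strict Implicit.
Unset Printing Implicit Defensive.
Import Order.TTheory GRing.Theory Num.Theory.
Local Open Scope ring_scope.

(** Let [f] be the indicator of unsatisfiability and [D_c f] its discrete
    derivatives. By Russo's formula it suffices that the total influence [I = p
    (1 - p) sum_c E (D_c f)] is of order at least [log n] as long as the
    probability of unsatisfiability stays in [[eta, 1 - eta]]. In the [p]-biased
    Fourier expansion the levels above [d], of order [log n], carry at most [I /
    d] of the variance; on the levels below, a noise operator of constant
    correlation loses only a small power of [n]. So it is enough that the noise
    stability of each [D_c f] is smaller than its mean by a larger power of [n].

    Write the random formula as [G :|: H] with [G], [H] independent and [G] a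
    small constant proportion of it: the noise stability of [D_c f] is the
    second moment over [G] of [E_H (D_c f)], and we bound the latter by a
    negative power of [n] for all [G] outside an event of probability much below
    [1 / n]. Typically the component in [G] of a variable of [c] has [O (log n)]
    clauses and all its sets of clauses involve more variables than clauses; by
    Hall's theorem it has a solution that makes [c] true. If [c] is pivotal,
    imposing this solution makes the formula unsatisfiable, and this amounts to
    [O (log n)] unit constraints on variables isolated in the rest of [G]. By
    the symmetries of [H], one such constraint acts like a constraint on a
    random literal; if it mattered with non-negligible probability, many
    variables would be frozen, hence many clauses pivotal, whereas a function
    with values in [[0, 1]] has at most [sqrt (N / (p (1 - p)))] pivotal clauses
    on average, by Cauchy-Schwarz. *)

(** * Product measures on a finite power set *)

Section ProductMeasure.
Variables (R : realFieldType) (T : finType).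
Implicit Types (p a b x : R) (F G H S : {set T}) (g : {set T} -> R).

Definition weight p F : R := \prod_c (if c \in F then p else 1 - p).

Definition expect p g : R := \sum_(F : {set T}) weight p F * g F.

Lemma sum_set_prod (h : T -> bool -> R) :
  \sum_(F : {set T}) \prod_c h c (c \in F) = \prod_c (h c true + h c false).
Proof.
rewrite bigA_distr; apply: eq_bigr => F _; apply: eq_bigr => c _.
by case: (c \in F).
Qed.

Lemma expect_eq p g1 g2 : (forall F, g1 F = g2 F) -> expect p g1 = expect p g2.
Proof. by move=> E; apply: eq_bigr => F _; rewrite E. Qed.

Lemma expectZ p x g : expect p (fun F => x * g F) = x * expect p g.
Proof. by rewrite mulr_sumr; apply: eq_bigr => F _; rewrite mulrCA. Qed.

Lemma expectD p g1 g2 :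
  expect p (fun F => g1 F + g2 F) = expect p g1 + expect p g2.
Proof. by rewrite -big_split; apply: eq_bigr => F _; rewrite mulrDr. Qed.

Lemma expect_sum p (I : Type) (r : seq I) (P : pred I) (h : I -> {set T} -> R) :
  expect p (fun F => \sum_(i <- r | P i) h i F) =
  \sum_(i <- r | P i) expect p (h i).
Proof.
by rewrite exchange_big; apply: eq_bigr => F _; rewrite mulr_sumr.
Qed.

Lemma expect_cst p x : expect p (fun=> x) = x.
Proof.
rewrite /expect -mulr_suml /weight.
rewrite (sum_set_prod (fun _ (b : bool) => if b then p else 1 - p)).
by rewrite big1 ?mul1r // => c _; rewrite addrC subrK.
Qed.

Lemma weight_ge0 p F : 0 <= p <= 1 -> 0 <= weight p F.
Proof.
by case/andP=> p0 p1; apply: prodr_ge0 => c _; case: ifP; rewrite ?subr_ge0.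
Qed.

Lemma ler_expect p g1 g2 : 0 <= p <= 1 -> (forall F, g1 F <= g2 F) ->
  expect p g1 <= expect p g2.
Proof.
by move=> hp le12; apply: ler_sum => F _; rewrite ler_wpM2l ?weight_ge0.
Qed.

Lemma expect_ge0 p g : 0 <= p <= 1 -> (forall F, 0 <= g F) -> 0 <= expect p g.
Proof. by move=> hp g0; apply: sumr_ge0 => F _; rewrite mulr_ge0 ?weight_ge0. Qed.

Lemma expect_le1 p g : 0 <= p <= 1 -> (forall F, g F <= 1) -> expect p g <= 1.
Proof. by move=> hp g1; rewrite -(expect_cst p 1); apply: ler_expect. Qed.

Lemma weightE p F : weight p F = p ^+ #|F| * (1 - p) ^+ (#|T| - #|F|).
Proof.
rewrite /weight (bigID (mem F)) /=; congr (_ * _).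
  by rewrite -prodr_const; apply: eq_bigr => c ->.
rewrite -cardsT -cardsDS ?subsetT // setTD -prodr_const.
by apply: eq_big => c; [rewrite inE | move=> /negbTE ->].
Qed.

Lemma expect_coord p g c :
  expect p g = p * expect p (fun F => g (c |: F)) +
               (1 - p) * expect p (fun F => g (F :\ c)).
Proof.
have split0 (h : {set T} -> R) : \sum_(F : {set T}) h F =
    \sum_(F : {set T} | c \notin F) (h (c |: F) + h F).
  rewrite (bigID (fun F : {set T} => c \in F)) /= big_split /=; congr (_ + _).
  rewrite [RHS](reindex_onto (fun F => F :\ c) (fun F => c |: F)) /=.
    apply: eq_big => [F|F cF]; last by rewrite setD1K.
    rewrite !inE eqxx /=; apply/idP/eqP => [/setD1K //|<-].
    by rewrite setU11.
  by move=> F cF; rewrite setU1K.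
rewrite /expect !split0 !mulr_sumr -big_split /=; apply: eq_bigr => F cF.
pose w := \prod_(d | d != c) (if d \in F then p else 1 - p).
have wU : weight p (c |: F) = p * w.
  rewrite /weight (bigD1 c) //= setU11; congr (_ * _).
  by apply: eq_bigr => d /negbTE dc; rewrite in_setU1 dc.
have w0 : weight p F = (1 - p) * w by rewrite /weight (bigD1 c) //= (negbTE cF).
have -> : c |: (c |: F) = c |: F by rewrite setUA setUid.
have -> : (c |: F) :\ c = F by rewrite setU1K.
have -> : F :\ c = F by apply/setDidPl; rewrite disjoint_sym disjoints1.
by rewrite wU w0; ring.
Qed.

Definition ddiff c g F : R := g (c |: F) - g (F :\ c).

(* The Fourier-Walsh coefficient of [g] at [S], up to the factor
   [(p * (1 - p)) ^ (#|S| / 2)]. *)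
Definition coeff p g S : R :=
  expect p (fun F => g F * \prod_(c in S) ((c \in F)%:R - p)).

(** Conditionally on [c], its factor in the character is [1 - p] with probability [p] and [- p] with
    probability [1 - p]; the two cases combine into the discrete derivative. *)
Lemma coeff_diff p g S c : c \notin S ->
  coeff p g (c |: S) = p * (1 - p) * coeff p (ddiff c g) S.
Proof.
move=> cS; rewrite /coeff (expect_coord _ _ c).
pose chi F := \prod_(d in S) ((d \in F)%:R - p).
have chiU F : \prod_(d in c |: S) ((d \in c |: F)%:R - p) = (1 - p) * chi F.
  rewrite big_setU1 //= setU11; congr (_ * _); apply: eq_bigr => d dS.
  by rewrite in_setU1; case: eqP dS cS => // -> ->.
have chiD F : \prod_(d in c |: S) ((d \in F :\ c)%:R - p) = - p * chi F.
  rewrite big_setU1 //= !inE eqxx sub0r; congr (_ * _); apply: eq_bigr => d dS.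
  by rewrite !inE; case: eqP dS cS => // -> ->.
rewrite -!expectZ -expectD; apply: expect_eq => F.
by rewrite chiU chiD /ddiff -/(chi F); ring.
Qed.

(** Expand each squared coefficient as a double sum over [F] and [H]. The sum over [S] then factors
    over coordinates: it vanishes unless [F = H], where it is the inverse weight. *)
Lemma parseval p g : 0 < p < 1 ->
  expect p (fun F => g F ^+ 2) =
  \sum_(S : {set T}) (p * (1 - p))^-1 ^+ #|S| * coeff p g S ^+ 2.
Proof.
move=> /andP[p0 p1]; have q0 : 1 - p != 0 by rewrite subr_eq0 gt_eqF.
have pn0 : p != 0 by rewrite gt_eqF.
set k := (p * (1 - p))^-1.
transitivity (\sum_(S : {set T}) \sum_(F : {set T}) \sum_(H : {set T})
   (weight p F * g F) * (weight p H * g H) *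
   \prod_(c in S) (k * ((c \in F)%:R - p) * ((c \in H)%:R - p))).
  rewrite exchange_big /=; apply: eq_bigr => F _; rewrite exchange_big /=.
  have ker H : \sum_(S : {set T}) \prod_(c in S)
      (k * ((c \in F)%:R - p) * ((c \in H)%:R - p)) =
      \prod_c (k * ((c \in F)%:R - p) * ((c \in H)%:R - p) + 1).
    rewrite bigA_distr; apply: eq_bigr => S _.
    by rewrite big_mkcond.
  under eq_bigr => H _ do rewrite -mulr_sumr ker.
  rewrite (bigD1 F) //= [X in _ + X]big1 ?addr0 => [|H HF].
    have -> : \prod_c (k * ((c \in F)%:R - p) * ((c \in F)%:R - p) + 1) =
        (weight p F)^-1.
      rewrite /weight -prodfV; apply: eq_bigr => c _.
      by rewrite /k; case: (c \in F) => /=; field; rewrite ?pn0 ?q0.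
    have wn0 : weight p F != 0.
      by apply/prodf_neq0 => c _; case: ifP.
    by field.
  have [c cFH] : exists c, (c \in F) != (c \in H).
    apply/existsP; apply: contraR HF; rewrite negb_exists => /forallP E.
    by apply/eqP/setP => c; have := E c; rewrite negbK => /eqP.
  rewrite [X in _ * X](bigD1 c) //=.
  have -> : k * ((c \in F)%:R - p) * ((c \in H)%:R - p) + 1 = 0.
    move: cFH; rewrite /k.
    by case: (c \in F); case: (c \in H) => //= _; field; rewrite ?pn0 ?q0.
  by rewrite mul0r mulr0.
apply: eq_bigr => S _; rewrite expr2 /coeff /expect mulr_suml mulr_sumr.
apply: eq_bigr => F _; rewrite !mulr_sumr; apply: eq_bigr => H _.
rewrite -prodr_const !mulrA -mulrA; rewrite !big_split /=.
by rewrite !mulrA; ring.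
Qed.

(** A product kernel on pairs is pushed forward along the union: three of the four pairs of bits at
    [c] put [c] into [F]. *)
Lemma sum_union (K : T -> bool -> bool -> R) g :
  \sum_(G : {set T}) \sum_(H : {set T})
    (\prod_c K c (c \in G) (c \in H)) * g (G :|: H) =
  \sum_(F : {set T}) g F * \prod_c (if c \in F then K c true false + K c false true +
                          K c true true else K c false false).
Proof.
have delta F G H : (\prod_c ((c \in F) == ((c \in G) || (c \in H)))%:R : R) =
    (F == G :|: H)%:R.
  case: eqP => [->|/eqP NE].
    by apply: big1 => c _; rewrite inE eqxx.
  have [c cF] : exists c, (c \in F) != ((c \in G) || (c \in H)).
    apply/existsP; apply: contraR NE; rewrite negb_exists => /forallP E.
    by apply/eqP/setP => c; have := E c; rewrite negbK inE => /eqP.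
  by rewrite (bigD1 c) //= (negbTE cF) mul0r.
transitivity (\sum_(F : {set T}) g F * \sum_(G : {set T}) \sum_(H : {set T})
   \prod_c (K c (c \in G) (c \in H) * ((c \in F) == ((c \in G) || (c \in H)))%:R)).
  under [RHS]eq_bigr => F _ do rewrite mulr_sumr.
  rewrite [RHS]exchange_big; apply: eq_bigr => G _.
  under [RHS]eq_bigr => F _ do rewrite mulr_sumr.
  rewrite [RHS]exchange_big; apply: eq_bigr => H _.
  rewrite (bigD1 (G :|: H)) //= big_split /= delta eqxx mulr1 mulrC.
  rewrite [X in _ + X]big1 ?addr0 // => F /negbTE NE.
  by rewrite big_split /= delta NE !mulr0.
apply: eq_bigr => F _; congr (_ * _).
pose L c e h := K c e h * ((c \in F) == (e || h))%:R.
transitivity (\sum_(G : {set T}) \prod_c (L c (c \in G) true + L c (c \in G) false)).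
  apply: eq_bigr => G _.
  exact: (sum_set_prod (fun c => L c (c \in G))).
rewrite (sum_set_prod (fun c e => L c e true + L c e false)) /L.
apply: eq_bigr => c _; case: (c \in F) => /=; ring.
Qed.

Lemma expect_union a b g :
  expect a (fun G => expect b (fun H => g (G :|: H))) =
  expect (a + b - a * b) g.
Proof.
have := sum_union (fun _ e h => (if e then a else 1 - a) *
  (if h then b else 1 - b)) g.
rewrite /expect => E; transitivity (\sum_(G : {set T}) \sum_(H : {set T})
   (\prod_(c : T) ((if c \in G then a else 1 - a) *
     (if c \in H then b else 1 - b))) * g (G :|: H)).
  apply: eq_bigr => G _; rewrite mulr_sumr; apply: eq_bigr => H _.
  by rewrite big_split mulrA.
rewrite E; apply: eq_bigr => F _; rewrite mulrC; congr (_ * _).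
by apply: eq_bigr => c _; case: ifP => _; ring.
Qed.

(** Averaging over [H] is diagonal in the Fourier basis: with [p = a + b - a * b], the conditional
    mean of [(c \in G)%:R - a] given the union [F] is [a / p] times [(c \in F)%:R - p]. *)
Lemma coeff_union a b g S : a + b - a * b != 0 ->
  coeff a (fun G => expect b (fun H => g (G :|: H))) S =
  (a / (a + b - a * b)) ^+ #|S| * coeff (a + b - a * b) g S.
Proof.
set p := a + b - a * b => pn0.
pose K c (e h : bool) := (if e then a else 1 - a) *
  (if h then b else 1 - b) * (if c \in S then e%:R - a else 1).
transitivity (\sum_(G : {set T}) \sum_(H : {set T})
  (\prod_c K c (c \in G) (c \in H)) * g (G :|: H)).
  apply: eq_bigr => G _; rewrite mulrA mulrAC mulr_sumr; apply: eq_bigr => H _.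
  by rewrite !big_split /= -big_mkcond /= /weight; ring.
rewrite sum_union /coeff -expectZ; apply: eq_bigr => F _.
rewrite [X in _ = _ * X]mulrCA [RHS]mulrCA; congr (_ * _).
rewrite -prodr_const -big_split /= /weight [X in _ = _ * X]big_mkcond /=.
rewrite -big_split /=.
apply: eq_bigr => c _; rewrite /K.
by case: (c \in F); case: (c \in S) => /=; rewrite ?mulr1 /p; field.
Qed.

Lemma coeff0 p g : coeff p g set0 = expect p g.
Proof. by apply: expect_eq => F; rewrite big_set0 mulr1. Qed.

(** Each [S] is counted once for every [c] in it, and [coeff_diff] moves it to the coefficient of
    the derivative at [S :\ c]. The terms with [c \in S] on the right are nonnegative and are
    dropped. *)
Lemma le_sum_diff p g x : 0 < p < 1 -> 0 <= x ->
  \sum_(S : {set T}) #|S|%:R * x ^+ #|S|.-1 *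
      ((p * (1 - p))^-1 ^+ #|S| * coeff p g S ^+ 2) <=
  p * (1 - p) * \sum_c \sum_(S : {set T})
      (x * (p * (1 - p))^-1) ^+ #|S| * coeff p (ddiff c g) S ^+ 2.
Proof.
move=> /andP[p0 p1] x0; set v := p * (1 - p).
have v0 : 0 < v by rewrite mulr_gt0 ?subr_gt0.
have vn0 : v != 0 by rewrite gt_eqF.
have E (S : {set T}) : #|S|%:R * x ^+ #|S|.-1 * (v^-1 ^+ #|S| * coeff p g S ^+ 2)
   = \sum_(c in S) x ^+ #|S|.-1 * (v^-1 ^+ #|S| * coeff p g S ^+ 2).
  by rewrite sumr_const -[RHS]mulr_natl mulrA.
under eq_bigr => S _ do rewrite E big_mkcond.
rewrite exchange_big mulr_sumr; apply: ler_sum => c _.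
rewrite -big_mkcond /=.
rewrite (reindex_onto (fun S => c |: S) (fun S => S :\ c)) /=; last first.
  by move=> S cS; rewrite setD1K.
rewrite mulr_sumr [leLHS]big_mkcond /=; apply: ler_sum => S _.
have [/andP[_ /eqP Sc]|_] := ifPn; last first.
  by rewrite mulr_ge0 ?(ltW v0) // mulr_ge0 ?sqr_ge0 // exprn_ge0 // divr_ge0 // ltW.
have cS : c \notin S by rewrite -Sc !inE eqxx.
rewrite cardsU1 cS add1n /= coeff_diff // -/v exprS (exprMn _ x) (exprMn _ v).
by rewrite le_eqVlt; apply/orP; left; apply/eqP; field.
Qed.

Lemma sum_diff_sqr p g : 0 < p < 1 ->
  \sum_(S : {set T}) #|S|%:R * ((p * (1 - p))^-1 ^+ #|S| * coeff p g S ^+ 2) <=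
  p * (1 - p) * \sum_c expect p (fun F => ddiff c g F ^+ 2).
Proof.
move=> hp; have := le_sum_diff g hp ler01.
under eq_bigr do rewrite expr1n mulr1; move=> /le_trans; apply.
under [X in _ * X <= _]eq_bigr => c _ do
  (under eq_bigr do rewrite mul1r); under eq_bigr do rewrite -parseval //.
exact: lexx.
Qed.

(** The value of [x] makes [x / (p * (1 - p))] equal to [(a / p) ^ 2 / (a * (1 - a))], the damping
    of [coeff_union] combined with Parseval at density [a]. *)
Lemma sum_diff_union a b p g (x : R := a * (1 - p) / (p * (1 - a))) :
  p = a + b - a * b -> 0 < p < 1 -> 0 < a < 1 ->
  \sum_(S : {set T}) #|S|%:R * x ^+ #|S|.-1 *
      ((p * (1 - p))^-1 ^+ #|S| * coeff p g S ^+ 2) <=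
  p * (1 - p) * \sum_c expect a
    (fun G => expect b (fun H => ddiff c g (G :|: H)) ^+ 2).
Proof.
move=> pE hp ha; have [/andP[p0 p1] /andP[a0 a1]] := (hp, ha).
have x0 : 0 <= x by rewrite divr_ge0 ?mulr_ge0 ?subr_ge0 ?ltW.
apply: le_trans (le_sum_diff g hp x0) _; rewrite le_eqVlt; apply/orP; left.
apply/eqP; congr (_ * _); apply: eq_bigr => c _.
rewrite (parseval _ ha); apply: eq_bigr => S _.
rewrite coeff_union -pE ?gt_eqF // (exprMn 2) [RHS]mulrA; congr (_ * _).
rewrite -exprM mulnC exprM -exprMn; congr (_ ^+ _); rewrite /x.
have q0 : 1 - p != 0 by rewrite gt_eqF // subr_gt0.
have q1 : 1 - a != 0 by rewrite gt_eqF // subr_gt0.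
by field; rewrite ?q0 ?q1 ?gt_eqF.
Qed.

(* Frequencies [#|S| > d] are controlled by the total influence; on the lower
   ones the noise operator loses at most a factor [x ^+ d], so their weight is
   controlled by the noise stability of the discrete derivatives. *)
Lemma variance_le a b p g d (x : R := a * (1 - p) / (p * (1 - a))) :
  p = a + b - a * b -> 0 < p < 1 -> 0 < a -> a <= p -> (0 < d)%N ->
  expect p (fun F => g F ^+ 2) - expect p g ^+ 2 <=
  p * (1 - p) * (\sum_c expect p (fun F => ddiff c g F ^+ 2)) / d%:R +
  x ^- d * (p * (1 - p) * \sum_c expect a
    (fun G => expect b (fun H => ddiff c g (G :|: H)) ^+ 2)).
Proof.
move=> pE hp a0 ap d0; have /andP[p0 p1] := hp.
have a1 : a < 1 by apply: le_lt_trans ap p1.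
have ha : 0 < a < 1 by rewrite a0.
have x0 : 0 < x by rewrite divr_gt0 ?mulr_gt0 ?subr_gt0.
have x1 : x <= 1.
  rewrite /x ler_pdivrMr ?mulr_gt0 ?subr_gt0 // mul1r !mulrBr !mulr1 mulrC.
  by rewrite lerB // mulrC.
have dR0 : 0 < d%:R :> R by rewrite ltr0n.
apply: (@le_trans _ _ (\sum_(S : {set T})
    (#|S|%:R / d%:R + x ^- d * (#|S|%:R * x ^+ #|S|.-1)) *
    ((p * (1 - p))^-1 ^+ #|S| * coeff p g S ^+ 2))).
  rewrite (parseval _ hp) (bigD1 set0) //= cards0 expr0 mul1r coeff0 addrAC subrr.
  rewrite add0r [leRHS](bigD1 set0) //= cards0 !mul0r mulr0 addr0 mul0r add0r.
  apply: ler_sum => S; rewrite -card_gt0 => S0.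
  have w0 : 0 <= (p * (1 - p))^-1 ^+ #|S| * coeff p g S ^+ 2.
    rewrite mulr_ge0 ?sqr_ge0 // exprn_ge0 // invr_ge0 mulr_ge0 ?(ltW p0) //.
    by rewrite subr_ge0 ltW.
  apply: ler_peMl => //.
  have [dS|Sd] := leqP d #|S|.
    rewrite -[leLHS]addr0 lerD //.
      by rewrite ler_pdivlMr // mul1r ler_nat.
    by rewrite mulr_ge0 ?invr_ge0 ?exprn_ge0 ?(ltW x0) // mulr_ge0 ?exprn_ge0 ?(ltW x0).
  rewrite -[leLHS]add0r lerD ?divr_ge0 ?ler0n // ler_pdivlMl ?exprn_gt0 // mulr1.
  apply: (@le_trans _ _ (x ^+ #|S|.-1)).
    by apply: ler_wiXn2l; rewrite ?(ltW x0) // (leq_trans (leq_pred _)) // ltnW.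
  by rewrite ler_peMl ?exprn_ge0 ?(ltW x0) // ler1n.
under eq_bigr do rewrite mulrDl; rewrite big_split /=; apply: lerD.
  under eq_bigr do rewrite mulrAC; rewrite -mulr_suml ler_pM2r ?invr_gt0 //.
  exact: sum_diff_sqr.
under eq_bigr do rewrite -mulrA.
rewrite -mulr_sumr ler_pM2l ?invr_gt0 ?exprn_gt0 //.
exact: sum_diff_union.
Qed.

(** As a polynomial in the density, the expectation has a formal derivative, to which the mean value
    theorem applies later over the reals. *)
Definition expect_poly g : {poly R} :=
  \sum_(F : {set T}) g F *: ('X^#|F| * (1 - 'X) ^+ (#|T| - #|F|)).

Lemma horner_expect_poly g p : (expect_poly g).[p] = expect p g.
Proof.
rewrite horner_sum; apply: eq_bigr => F _.
by rewrite weightE !hornerE /=; ring.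
Qed.

Lemma coeff1 p g c : coeff p g [set c] = p * (1 - p) * expect p (ddiff c g).
Proof. by rewrite -(setU0 [set c]) coeff_diff ?inE // coeff0. Qed.

(** By [coeff1] the right side is a sum of level-one coefficients. The comparison is termwise: the
    logarithmic derivative of the weight of [F] is [(#|F| - #|T| * p) / (p * (1 - p))]. *)
Lemma russo g p : 0 < p < 1 ->
  (expect_poly g)^`().[p] = \sum_c expect p (ddiff c g).
Proof.
move=> /andP[p0 p1].
have vn0 : p * (1 - p) != 0 by rewrite gt_eqF // mulr_gt0 ?subr_gt0.
apply: (mulfI vn0); rewrite mulr_sumr.
under eq_bigr => c _ do rewrite -coeff1 /coeff.
rewrite -expect_sum raddf_sum horner_sum mulr_sumr; apply: eq_bigr => F _.
have -> : \sum_(c : T) g F * \prod_(d in [set c]) ((d \in F)%:R - p) =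
    g F * (#|F|%:R - #|T|%:R * p).
  rewrite -mulr_sumr; congr (_ * _).
  under eq_bigr do rewrite big_set1.
  rewrite sumrB sumr_const mulr_natl; congr (_ - _).
  by rewrite -natr_sum -sum1_card [in RHS]big_mkcond.
have -> : #|T|%:R = #|F|%:R + (#|T| - #|F|)%:R :> R.
  by rewrite -natrD subnKC // max_card.
rewrite weightE; move: (#|F|) (#|T| - #|F|)%N => i j.
have dX : (1 - 'X)^`() = - 1 :> {poly R}.
  by rewrite derivB derivX -polyC1 derivC sub0r.
rewrite /= derivZ derivM derivXn deriv_exp dX hornerZ hornerD !hornerM !hornerMn.
rewrite !hornerE /=.
(* Zero exponents are separated because the derivatives of powers involve truncated predecessors. *)
case: i j => [|i] [|j]; rewrite /= ?mulr0n ?exprS; ring.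
Qed.

(** Cauchy-Schwarz, from the nonnegativity of the sum of squared deviations from the mean. *)
Lemma sqr_sum_le (x : T -> R) : (\sum_c x c) ^+ 2 <= #|T|%:R * \sum_c x c ^+ 2.
Proof.
have [T0|T0] := posnP #|T|.
  rewrite T0 mul0r [X in X ^+ 2]big1 ?expr0n // => c _.
  by have := card0_eq T0 c; rewrite inE.
have N0 : 0 < #|T|%:R :> R by rewrite ltr0n.
set X := \sum_c x c; have : 0 <= \sum_c (x c - X / #|T|%:R) ^+ 2.
  by apply: sumr_ge0 => c _; apply: sqr_ge0.
under eq_bigr do rewrite sqrrB.
have E : \sum_(c : T) (X / #|T|%:R) ^+ 2 = #|T|%:R * (X / #|T|%:R) ^+ 2.
  by rewrite sumr_const mulr_natl.
rewrite big_split sumrB /= E sumrMnl -mulr_suml -/X => h.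
rewrite -ler_pdivrMl // -subr_ge0; apply: le_trans h _.
by rewrite le_eqVlt; apply/orP; left; apply/eqP; field; rewrite gt_eqF.
Qed.

(** Cauchy-Schwarz over the coordinates, then Parseval restricted to singletons, whose share is at
    most the second moment of [g]. *)
Lemma sum_influence_le p g : 0 < p < 1 -> (forall F, g F ^+ 2 <= 1) ->
  (\sum_c expect p (ddiff c g)) ^+ 2 <= #|T|%:R / (p * (1 - p)).
Proof.
move=> hp g1; have /andP[p0 p1] := hp.
have v0 : 0 < p * (1 - p) by rewrite mulr_gt0 ?subr_gt0.
apply: le_trans (sqr_sum_le _) _; rewrite ler_wpM2l ?ler0n //.
rewrite -(ler_pM2l v0) mulfV ?gt_eqF // mulr_sumr.
have hp' : 0 <= p <= 1 by rewrite !ltW.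
apply: le_trans (expect_le1 hp' g1); rewrite (parseval _ hp).
have q0 : 1 - p != 0 by rewrite gt_eqF // subr_gt0.
have -> : \sum_c p * (1 - p) * expect p (ddiff c g) ^+ 2 =
  \sum_(S in [set [set c] | c : T]) (p * (1 - p))^-1 ^+ #|S| * coeff p g S ^+ 2.
  rewrite big_imset /=; last by move=> c d _ _; apply: set1_inj.
  apply: eq_big => [c|c _]; first by rewrite inE.
  by rewrite cards1 expr1 coeff1; field; rewrite q0 gt_eqF.
rewrite big_mkcond /=; apply: ler_sum => S _; case: ifP => // _.
by rewrite mulr_ge0 ?sqr_ge0 // exprn_ge0 // invr_ge0 ltW.
Qed.

Lemma expect_setI p (Q A : {set T}) : Q \subset A ->
  expect p (fun G => (G :&: A == Q)%:R) = p ^+ #|Q| * (1 - p) ^+ (#|A| - #|Q|).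
Proof.
move=> /subsetP QA.
have ind (G : {set T}) : ((G :&: A == Q)%:R : R) =
    \prod_c ((c \in A) ==> ((c \in G) == (c \in Q)))%:R.
  case: eqP => [GQ|/eqP GQ].
    rewrite big1 // => c _; rewrite -GQ inE.
    by case: (c \in A); rewrite ?andbT ?andbF ?eqxx.
  have [c cN] : exists c, ~~ ((c \in A) ==> ((c \in G) == (c \in Q))).
    apply/existsP; apply: contraR GQ; rewrite negb_exists => /forallP E.
    apply/eqP/setP => c; have := E c; rewrite negbK inE => /implyP.
    case: (boolP (c \in A)) => [cA /(_ isT)/eqP ->|cA _]; first by rewrite andbT.
    by rewrite andbF; apply/esym/negbTE; apply: contra cA; apply: QA.
  by rewrite (bigD1 c) //= (negbTE cN) mul0r.
transitivity (\prod_c (if c \in A then if c \in Q then p else 1 - p else 1)).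
  transitivity (\sum_(G : {set T}) \prod_c
    ((if c \in G then p else 1 - p) * ((c \in A) ==> ((c \in G) == (c \in Q)))%:R)).
    by apply: eq_bigr => G _; rewrite ind big_split.
  rewrite (sum_set_prod (fun c e => (if e then p else 1 - p) *
    ((c \in A) ==> (e == (c \in Q)))%:R)).
  apply: eq_bigr => c _.
  by case: (c \in A); case: (c \in Q) => /=;
    rewrite ?mulr0 ?mulr1 ?addr0 ?add0r // addrC subrK.
rewrite -big_mkcond (bigID (mem Q)) /=; congr (_ * _).
  rewrite -prodr_const; apply: eq_big => [c|c /andP[_ ->]] //.
  by rewrite andbC; case: (boolP (c \in Q)) => // /QA ->.
rewrite -cardsDS; last exact/subsetP.
rewrite -prodr_const; apply: eq_big => [c|c /andP[_ /negbTE ->]] //.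
by rewrite inE andbC.
Qed.

Lemma expect_subset p (Q : {set T}) :
  expect p (fun G => (Q \subset G)%:R) = p ^+ #|Q|.
Proof.
have /= := expect_setI p (subxx Q); rewrite subnn mulr1 => <-.
by apply: expect_eq => G; rewrite (sameP setIidPr eqP).
Qed.

Lemma expect_imset p g (h : T -> T) : injective h ->
  expect p (fun F => g (h @: F)) = expect p g.
Proof.
move=> hI; rewrite [RHS](reindex_inj (imset_inj hI)) /=.
by apply: eq_bigr => F _; rewrite !weightE card_imset.
Qed.

End ProductMeasure.

(** * Hall's theorem and components of a formula *)

Section Clauses.
Variables n k : nat.
Local Notation clause := (clause n k).
Local Notation assignment := (assignment n).
Implicit Types (c : clause) (F G H Q P : {set clause}) (x y : assignment).
Implicit Types (U V A : {set 'I_n}) (v : 'I_n).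

Definition vars c : {set 'I_n} := [set i | val c i != None].

Definition vars_of F : {set 'I_n} := \bigcup_(c in F) vars c.

Definition satisfies x F : bool := [forall c in F, ~~ falsifies x c].

Definition touching U : {set clause} := [set c | ~~ [disjoint vars c & U]].

Lemma card_vars c : #|vars c| = k.
Proof. exact/eqP/(valP c). Qed.

Lemma vars_ofU F G : vars_of (F :|: G) = vars_of F :|: vars_of G.
Proof. exact: bigcup_setU. Qed.

Lemma vars_ofS F G : F \subset G -> vars_of F \subset vars_of G.
Proof. by move=> /setIidPl <-; rewrite -{2}(setID G F) setIC vars_ofU subsetUl. Qed.

Lemma vars_sub c F : c \in F -> vars c \subset vars_of F.
Proof. by move=> cF; apply: bigcup_sup. Qed.

Lemma card_vars_of F : (#|vars_of F| <= k * #|F|)%N.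
Proof.
rewrite mulnC -sum_nat_const /vars_of.
apply: (big_ind2 (fun (U : {set 'I_n}) m => #|U| <= m)%N) => [|U a V b Ua Vb|c _].
- by rewrite cards0.
- exact: leq_trans (leq_card_setU _ _) (leq_add Ua Vb).
- by rewrite card_vars.
Qed.

Lemma falsifies_val x c v b : falsifies x c -> val c v = Some b -> x v = b.
Proof. by move=> /forallP/(_ v) + E; rewrite E => /eqP. Qed.

Lemma eq_falsifies x y c : {in vars c, x =1 y} -> falsifies x c = falsifies y c.
Proof.
move=> xy; apply: eq_forallb => i; case E: (val c i) => [b|] //.
by rewrite xy // inE E.
Qed.

Lemma satisfiesP x F : reflect {in F, forall c, ~~ falsifies x c} (satisfies x F).
Proof. exact: 'forall_in_idP. Qed.

Lemma satisfiesS x F G : F \subset G -> satisfies x G -> satisfies x F.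
Proof. by move=> /subsetP FG /satisfiesP h; apply/satisfiesP => c /FG /h. Qed.

Lemma satisfiesU x F G : satisfies x (F :|: G) = satisfies x F && satisfies x G.
Proof.
apply/satisfiesP/andP => [h|[/satisfiesP hF /satisfiesP hG] c].
  by split; apply/satisfiesP => c cF; apply: h; rewrite inE cF ?orbT.
by rewrite inE => /orP[/hF|/hG].
Qed.

Lemma eq_satisfies x y F : {in vars_of F, x =1 y} -> satisfies x F = satisfies y F.
Proof.
move=> xy; apply: eq_forallb_in => c cF; congr (~~ _); apply: eq_falsifies => i ic.
by apply: xy; apply: subsetP (vars_sub cF) _ ic.
Qed.

Lemma touchingS U V : U \subset V -> touching U \subset touching V.
Proof.
move=> UV; apply/subsetP => c; rewrite !inE; apply: contra.
by apply: disjointWr.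
Qed.

(* Hall's marriage argument, producing an assignment instead of a matching:
   clauses are satisfied through distinct variables outside [A]. *)
Lemma hall_satisfies Q A x :
  (forall P, P \subset Q -> (#|P| <= #|vars_of P :\: A|)%N) ->
  exists2 y : assignment, {in A, y =1 x} & satisfies y Q.
Proof.
have [m] := ubnP #|Q|; elim: m => // m IH in Q A x *; rewrite ltnS => Qm hall.
have [->|/set0Pn[c cQ]] := eqVneq Q set0.
  by exists x => //; apply/satisfiesP => c; rewrite inE.
(* A tight proper subset [P] splits the problem: satisfy [P] first, then the rest without touching
   [A] or the variables of [P]. Hall's condition for the rest is the one for [P' :|: P] minus the
   tight equality. *)
case: (pickP [pred P : {set clause} | [&& P \proper Q, P != set0 &
    #|vars_of P :\: A| == #|P|]]) => [P /and3P[PQ P0 /eqP tight]|loose].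
  have PsQ := proper_sub PQ.
  have [||y1 y1x satP] := IH P A x.
  - exact: leq_trans (proper_card PQ) Qm.
  - by move=> P' P'P; apply: hall (subset_trans P'P PsQ).
  have [||y2 y2y1 satD] := IH (Q :\: P) (A :|: vars_of P) y1.
  - rewrite cardsDS //; rewrite -card_gt0 in P0.
    by have := subset_leq_card PsQ; lia.
  - move=> P' P'Q; have P'P : [disjoint P' & P].
      by have := P'Q; rewrite subsetD => /andP[].
    have := hall (P' :|: P); rewrite subUset PsQ (subset_trans P'Q (subsetDl _ _)).
    move=> /(_ isT); rewrite cardsU disjoint_setI0 // cards0 subn0 vars_ofU.
    rewrite -tight => h; suff : (#|(vars_of P' :|: vars_of P) :\: A| <=
      #|vars_of P' :\: (A :|: vars_of P)| + #|vars_of P :\: A|)%N by lia.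
    apply: leq_trans (leq_card_setU _ _); apply: subset_leq_card.
    apply/subsetP => i; rewrite !inE.
    by case: (i \in A); case: (i \in vars_of P); rewrite ?orbT ?orbF.
  exists y2; first by move=> i iA; rewrite y2y1 ?inE ?iA // y1x.
  rewrite -(setID Q P) satisfiesU satD andbT setIC (setIidPl PsQ).
  rewrite (@eq_satisfies y2 y1) // => i iP.
  by rewrite y2y1 // inE iP orbT.
(* Without a tight set, any variable of [c] outside [A] may serve [c]: the slack of one pays for its
   removal. *)
have sc : [set c] \subset Q by rewrite sub1set.
have := hall _ sc; rewrite cards1 card_gt0 => /set0Pn[i].
rewrite /vars_of big_set1 !inE => /andP[iA].
case Ei: (val c i) => [b|] // _.
pose y1 : assignment := [ffun j => if j == i then ~~ b else x j].
have [||y2 y2y1 satD] := IH (Q :\ c) (i |: A) y1.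
- by have := cardsD1 c Q; rewrite cQ; lia.
- move=> P PQc; have PQ := subset_trans PQc (subsetDl _ _).
  have [->|P0] := eqVneq P set0; first by rewrite cards0.
  have Pp : P \proper Q.
    apply/properP; split=> //; exists c => //.
    by apply/negP => /(subsetP PQc); rewrite !inE eqxx.
  have := loose P; rewrite /= Pp P0 /= => /eqP/eqP ne.
  have := hall P PQ; rewrite leq_eqVlt eq_sym (negbTE ne) /= => lt.
  have := cardsD1 i (vars_of P :\: A); rewrite setDDl setUC.
  by case: (i \in _) => /=; lia.
exists y2.
  move=> j jA; rewrite y2y1 ?inE ?jA ?orbT // ffunE.
  by case: eqP jA iA => // -> ->.
rewrite -(setD1K cQ) satisfiesU satD andbT; apply/satisfiesP => d /set1P ->.
apply/negP => /falsifies_val/(_ Ei); rewrite y2y1 ?setU11 // ffunE eqxx.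
by case: b {Ei y1 y2y1}.
Qed.

Definition component_step G v X : {set clause} := G :&: touching (v |: vars_of X).

(** The least fixed point collects the clauses of [G] reached from [v] through shared variables. *)
Definition component G v : {set clause} := fixset (component_step G v).

Lemma component_step_mono G v :
  {homo component_step G v : X Y / X \subset Y >-> X \subset Y}.
Proof. by move=> X Y XY; rewrite setIS // touchingS // setUS // vars_ofS. Qed.

Lemma component_fix G v :
  G :&: touching (v |: vars_of (component G v)) = component G v.
Proof. exact: (fixsetK (component_step_mono G v)). Qed.

Lemma component_sub G v : component G v \subset G.
Proof. by rewrite -component_fix subsetIl. Qed.

Lemma component_touching G v :
  component G v \subset touching (v |: vars_of (component G v)).
Proof. by rewrite -{1}component_fix subsetIr. Qed.

(** Exploring from [v] only examines clauses touching [v] or the component found, so a prescribed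
    component is a cylinder event, with an explicit probability. *)
Lemma eq_component F G v :
  (component G v == component F v) =
  (G :&: touching (v |: vars_of (component F v)) == component F v).
Proof.
apply/eqP/eqP => [<-|GF]; first exact: component_fix.
suff E i : iter i (component_step G v) set0 = iter i (component_step F v) set0.
  by rewrite /component /fixset E.
elim: i => //= i ->; set X := iter i _ _.
have XF : X \subset component F v := iter_sub_fix (component_step_mono F v) i.
have N : touching (v |: vars_of X) \subset touching (v |: vars_of (component F v)).
  by rewrite touchingS // setUS // vars_ofS.
by rewrite /component_step -(setIidPr N) !setIA GF component_fix.
Qed.

End Clauses.

(** * Symmetries and unit constraints *)

Section Symmetry.
Variables n k : nat.
Local Notation clause := (clause n k).
Local Notation assignment := (assignment n).
Implicit Types (c : clause) (F G H Q : {set clause}) (x y : assignment).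
Implicit Types (U V A S : {set 'I_n}) (u v : 'I_n) (P : pred assignment).

Lemma exists_clause S x : #|S| = k ->
  exists c, forall i, val c i = if i \in S then Some (x i) else None.
Proof.
move=> Sk; pose d : {ffun 'I_n -> option bool} :=
  [ffun i => if i \in S then Some (x i) else None].
have dk : #|[set i | d i != None]| == k.
  rewrite -Sk; apply/eqP/eq_card => i; rewrite inE ffunE.
  by case: ifP.
by exists (Sub d dk) => i; rewrite SubK ffunE.
Qed.

Section Action.
Variables (s : {perm 'I_n}) (f : 'I_n -> bool).

(** [s] renames the variables and [f] flips signs; these signed permutations preserve satisfiability
    and the product measure. *)
Definition act_fun (d : {ffun 'I_n -> option bool}) : {ffun 'I_n -> option bool} :=
  [ffun i => omap (addb (f i)) (d (s i))].

Lemma act_clause_subproof c : #|[set i | act_fun (val c) i != None]| == k.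
Proof.
apply/eqP; rewrite -[RHS](card_vars c) -(card_preimset (vars c) (@perm_inj _ s)).
apply/eq_card => i; rewrite !inE ffunE.
by case: (val c (s i)).
Qed.

Definition act_clause c : clause := Sub (act_fun (val c)) (act_clause_subproof c).

Definition act_assignment x : assignment := [ffun i => f i (+) x (s i)].

Lemma act_clause_inj : injective act_clause.
Proof.
move=> c d /(congr1 val); rewrite !SubK => /ffunP E; apply/val_inj/ffunP => i.
have := E ((s^-1)%g i); rewrite !ffunE permKV.
case: (val c i) => [a|]; case: (val d i) => [b|] //= [].
by move/addbI ->.
Qed.

Lemma act_assignment_inj : injective act_assignment.
Proof.
move=> x y /ffunP E; apply/ffunP => i.
by have := E ((s^-1)%g i); rewrite !ffunE permKV => /addbI.
Qed.

Lemma falsifies_act x c :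
  falsifies (act_assignment x) (act_clause c) = falsifies x c.
Proof.
apply/forallP/forallP => h i.
  have := h ((s^-1)%g i); rewrite SubK !ffunE permKV.
  by case: (val c i) => //= b; rewrite (inj_eq (@addbI _)).
have := h (s i); rewrite SubK !ffunE.
by case: (val c (s i)) => //= b; rewrite (inj_eq (@addbI _)).
Qed.

Lemma satisfies_act x F :
  satisfies (act_assignment x) (act_clause @: F) = satisfies x F.
Proof.
apply/satisfiesP/satisfiesP => h c.
  by move=> cF; rewrite -falsifies_act h // imset_f.
by case/imsetP => d dF ->; rewrite falsifies_act h.
Qed.

End Action.

Definition satp P F : bool := [exists x, P x && satisfies x F].

Lemma satpP P F : reflect (exists2 x, P x & satisfies x F) (satp P F).
Proof.
by apply: (iffP existsP) => -[x];
  [case/andP; exists x|move=> Px ?; exists x; rewrite Px].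
Qed.

Lemma satpS P F G : F \subset G -> satp P G -> satp P F.
Proof.
by move=> FG /satpP[x Px xG]; apply/satpP; exists x => //; apply: satisfiesS xG.
Qed.

Lemma satp_act s f P P' F : (forall x, P' (act_assignment s f x) = P x) ->
  satp P' (act_clause s f @: F) = satp P F.
Proof.
move=> PP'; apply/satpP/satpP => -[x Px xF].
  have inj := @act_assignment_inj s f.
  exists (invF inj x); first by rewrite -PP' f_invF.
  by rewrite -(satisfies_act s f) f_invF.
by exists (act_assignment s f x); rewrite ?PP' ?satisfies_act.
Qed.

Section Units.
Variables (R : realFieldType) (G : {set clause}) (tau : assignment).
Implicit Types (us : seq 'I_n).

Definition agree us x : bool := all (fun i => x i == tau i) us.

(** Here [e] is the excluded value: solutions exist, and all of them give [u] the value [~~ e]. *)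
Definition forced us u e H : bool :=
  satp (agree us) (G :|: H) &&
  ~~ satp (fun x => agree us x && (x u == e)) (G :|: H).

Definition free us : {set 'I_n} := [set i | (i \notin vars_of G) && (i \notin us)].

(** Exchange [u] and [u'], with a sign flip at [u'] when [e] and [e'] differ. This fixes [G] and the
    constraints [us], where neither variable occurs, and preserves the law of [H]. *)
Lemma expect_forced_eq (b : R) us u u' e e' :
  u \in free us -> u' \in free us ->
  expect b (fun H => (forced us u' e' H)%:R) =
  expect b (fun H => (forced us u e H)%:R).
Proof.
rewrite !inE => /andP[uG uu] /andP[u'G u'u].
pose s := tperm u u'; pose f i := (i == u') && (e (+) e').
have neq i A : u \notin A -> u' \notin A -> i \in A -> s i = i /\ f i = false.
  move=> uA u'A iA; rewrite /s /f; split.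
    by rewrite tpermD //; apply/eqP => E; rewrite E iA in uA u'A *.
  by case: eqP iA u'A => // -> ->.
rewrite -(expect_imset b _ (@act_clause_inj s f)); apply: expect_eq => H.
congr (_%:R); rewrite /forced.
have -> : G :|: [set act_clause s f c | c in H] = act_clause s f @: (G :|: H).
  rewrite imsetU; congr (_ :|: _).
  rewrite -[LHS]imset_id; apply: eq_in_imset => c cG.
  apply/val_inj/ffunP => i; rewrite SubK ffunE.
  have vG : vars c \subset vars_of G by apply: vars_sub.
  have [iv|iv] := boolP (i \in vars_of G).
    by have [-> ->] := neq i _ uG u'G iv; case: (val c i) => //= -[].
  have nv j : j \notin vars_of G -> val c j = None.
    move=> jG; apply/eqP; have : j \notin vars c by apply: contra jG; apply: subsetP.
    by rewrite inE negbK.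
  by rewrite (nv i) // nv // /s; case: tpermP.
have ag x : agree us (act_assignment s f x) = agree us x.
  apply: eq_in_all => i iu; rewrite ffunE.
  have := neq i [set j in us]; rewrite !inE => /(_ uu u'u iu)[-> ->].
  by [].
congr (_ && ~~ _); apply: satp_act => x; rewrite ?ag //.
by rewrite ffunE /s tpermR /f eqxx /=; case: e {f ag neq}; case: e'; case: (x u).
Qed.

Definition frozen us H : {set 'I_n} :=
  [set u in free us | forced us u true H || forced us u false H].

Lemma card_frozen us H :
  (\sum_(u in free us) (forced us u true H + forced us u false H) =
   #|frozen us H|)%N.
Proof.
rewrite -sum1_card big_mkcond [RHS]big_mkcond; apply: eq_bigr => u _.
rewrite [u \in frozen us H]inE; case: ifP => //= _.
have : ~~ (forced us u true H && forced us u false H).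
  apply/negP => /andP[/andP[/satpP[x ax xF] /negP nt] /andP[_ /negP nf]].
  case E: (x u); [case: nt|case: nf]; apply/satpP; exists x => //.
    by rewrite ax E.
  by rewrite ax E.
by case: (forced us u true H); case: (forced us u false H).
Qed.

Definition unsat_with us H : R := (~~ satp (agree us) (G :|: H))%:R.

Lemma diff_unsat_with us c H :
  ddiff c (unsat_with us) H =
  (satp (agree us) (G :|: H :\ c) && ~~ satp (agree us) (G :|: (c |: H)))%:R.
Proof.
have le : satp (agree us) (G :|: (c |: H)) -> satp (agree us) (G :|: H :\ c).
  by apply: satpS; rewrite setUS // (subset_trans (subsetDl _ _)) // subsetUr.
rewrite /ddiff /unsat_with; case: (satp _ (G :|: (c |: H))) le => [/(_ isT) ->|_] /=.
  by rewrite subrr.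
by case: satp; rewrite /= ?subr0 ?subrr.
Qed.

(* A clause all of whose variables are frozen, at the values that falsify it,
   turns the formula unsatisfiable. *)
Lemma binom_frozen_le us H : (0 < k)%N ->
  ('C(#|frozen us H|, k)%:R : R) <= \sum_c ddiff c (unsat_with us) H.
Proof.
move=> k0; under eq_bigr do rewrite diff_unsat_with; rewrite -natr_sum ler_nat.
(* Without a solution nothing is frozen, and ['C(0, k)] is zero because [k] is positive. *)
have [[x0 ax0 x0H]|nosol] := satpP (agree us) (G :|: H); last first.
  suff -> : frozen us H = set0 by rewrite cards0 bin0n eqn0Ngt k0.
  apply/setP => u; rewrite !inE /forced.
  by case: satpP => [[x ax xH]|_]; [case: nosol; exists x|rewrite andbF].
have frozenE u y : u \in frozen us H -> agree us y -> satisfies y (G :|: H) ->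
    y u = x0 u.
  rewrite inE => /andP[_] + ay yH.
  have ne z e : agree us z -> satisfies z (G :|: H) -> forced us u e H -> z u != e.
    move=> az zH /andP[_]; apply: contra => /eqP zu; apply/satpP; exists z => //.
    by rewrite az zu eqxx.
  case/orP=> h; move: (ne _ _ ay yH h) (ne _ _ ax0 x0H h).
    by case: (y u); case: (x0 u).
  by case: (y u); case: (x0 u).
pose cond c := satp (agree us) (G :|: H :\ c) &&
  ~~ satp (agree us) (G :|: (c |: H)).
have -> : (\sum_c cond c = #|[set c | cond c]|)%N.
  rewrite -sum1_card [RHS]big_mkcond; apply: eq_bigr => c _; rewrite inE.
  by case: (cond c).
rewrite -cards_draws; apply: leq_trans (leq_imset_card (@vars n k) _).
apply: subset_leq_card; apply/subsetP => S; rewrite inE => /andP[Sf /eqP Sk].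
have [c cE] := exists_clause x0 Sk; apply/imsetP; exists c; last first.
  by apply/setP => i; rewrite inE cE; case: ifP.
rewrite inE /cond; apply/andP; split.
  apply/satpP; exists x0 => //; apply: satisfiesS x0H.
  by rewrite setUS // subsetDl.
apply/negP => /satpP[y ay ys].
have yH : satisfies y (G :|: H) by apply: satisfiesS ys; rewrite setUS // subsetUr.
have /satisfiesP/(_ c) := ys; rewrite !inE eqxx orbT => /(_ isT)/negP; apply.
apply/forallP => i; rewrite cE; case: ifP => // iS.
by rewrite (frozenE i y) //; apply: subsetP Sf _ iS.
Qed.

(** By symmetry the left side is the expected number of frozen variables. If there are at least [m]
    of them, at least ['C(m, k)] clauses are pivotal, and the expected number of pivotal clauses is
    at most [X]. *)
Lemma expect_forced_le (b X : R) us u e m : (0 < k)%N -> 0 < b < 1 -> 0 <= X ->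
  #|{: clause}|%:R / (b * (1 - b)) <= X ^+ 2 -> (k <= m)%N -> u \in free us ->
  (2 * #|free us|)%:R * expect b (fun H => (forced us u e H)%:R) <=
  m%:R + n%:R * (X / 'C(m, k)%:R).
Proof.
move=> k0 hb X0 hX km uf; have hb' : 0 <= b <= 1 by case/andP: hb => /ltW-> /ltW->.
have C0 : 0 < 'C(m, k)%:R :> R by rewrite ltr0n bin_gt0.
pose D H := \sum_c ddiff c (unsat_with us) H.
have ED : expect b D <= X.
  apply: le_trans (ler_norm _) _.
  rewrite -(@ler_pXn2r _ 2) ?nnegrE // real_normK ?num_real //.
  rewrite expect_sum; apply: le_trans (sum_influence_le hb _) hX.
  by move=> H; rewrite /unsat_with; case: (~~ _); rewrite ?expr1n ?expr0n ?ler01.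
have -> : (2 * #|free us|)%:R * expect b (fun H => (forced us u e H)%:R) =
    expect b (fun H => #|frozen us H|%:R).
  under [RHS]expect_eq do rewrite -card_frozen natr_sum.
  rewrite expect_sum (eq_bigr (fun=> 2 * expect b (fun H => (forced us u e H)%:R))).
    by rewrite sumr_const mulrC natrM -[RHS]mulr_natl; ring.
  move=> w wf; rewrite (expect_eq _ (g2 := fun H => (forced us w true H)%:R +
    (forced us w false H)%:R)); last by move=> H; rewrite natrD.
  by rewrite expectD !(@expect_forced_eq b us u _ e) // mulr2n mulrDl !mul1r.
apply: (@le_trans _ _ (expect b (fun H => m%:R + n%:R / 'C(m, k)%:R * D H))).
  apply: ler_expect => // H; apply: (@le_trans _ _
      (m%:R + n%:R / 'C(m, k)%:R * 'C(#|frozen us H|, k)%:R)); last first.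
    by rewrite lerD2l ler_wpM2l ?divr_ge0 ?ler0n ?binom_frozen_le.
  have [lt|ge] := ltnP #|frozen us H| m.
    by rewrite ler_wpDr ?ler_nat ?(ltnW lt) // mulr_ge0 ?divr_ge0 ?ler0n.
  rewrite ler_wpDl ?ler0n //; apply: (@le_trans _ _ n%:R).
    by rewrite ler_nat (leq_trans (max_card _)) ?card_ord.
  rewrite -mulrA ler_peMr ?ler0n //.
  by rewrite mulrC ler_pdivlMr // mul1r ler_nat leq_bin2l.
rewrite expectD expect_cst expectZ lerD2l -mulrA ler_wpM2l ?ler0n //.
by rewrite mulrC ler_wpM2r // invr_ge0 ltW.
Qed.

(* The variables of [us] are set one at a time. *)
Lemma expect_units_le (b X : R) us m : (0 < k)%N -> 0 < b < 1 -> 0 <= X ->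
  #|{: clause}|%:R / (b * (1 - b)) <= X ^+ 2 -> (k <= m)%N ->
  uniq us -> all (fun u => u \notin vars_of G) us ->
  (0 < n)%N -> (2 * (#|vars_of G| + size us) <= n)%N ->
  expect b (fun H => (satp predT (G :|: H) && ~~ satp (agree us) (G :|: H))%:R)
  <= (size us)%:R * (m%:R / n%:R + X / 'C(m, k)%:R).
Proof.
move=> k0 hb X0 hX km + + n0; have hb' : 0 <= b <= 1 by case/andP: hb => /ltW-> /ltW->.
set del := _ + _; elim: us => [|u us IH] /=.
  move=> _ _ _; rewrite mul0r (expect_eq _ (g2 := fun=> 0)) ?expect_cst // => H.
  by rewrite [satp (agree [::]) _](_ : _ = satp predT (G :|: H)) ?andbN.
move=> /andP[uus Uus] /andP[uG usG] small.
apply: (@le_trans _ _ (expect b (fun H =>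
  (satp predT (G :|: H) && ~~ satp (agree us) (G :|: H))%:R +
  (forced us u (tau u) H)%:R))).
  apply: ler_expect => // H; rewrite /forced -natrD ler_nat.
  rewrite (_ : satp (agree (u :: us)) _ =
    satp (fun x => agree us x && (x u == tau u)) (G :|: H)).
    by case: (satp predT); case: (satp (agree us)); case: satp.
  by apply: eq_existsb => x; rewrite /agree /= [_ && all _ _]andbC.
have uf : u \in free us by rewrite inE uG.
rewrite expectD -natr1 mulrDl mul1r lerD //; first apply: IH => //.
  by apply: leq_trans small; rewrite leq_mul2l leq_add2l leqnSn orbT.
have nR : 0 < n%:R :> R by rewrite ltr0n.
have h := expect_forced_le (tau u) k0 hb X0 hX km uf.
rewrite -(ler_pM2l nR) /del mulrDr mulrCA divff ?mulr1 ?gt_eqF //.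
apply: le_trans h; rewrite ler_wpM2r ?expect_ge0 // ler_nat.
(* Variables that are not free lie in [G] or [us], at most half of all, so [2 * #|free us|] is at
   least [n]. *)
suff : (#|vars_of G| + size us + #|free us| >= n)%N.
  by move: small => /=; move: #|vars_of G| #|free us| (size us) => a b' c; clear; lia.
rewrite -{1}(card_ord n) -(cardC (mem (free us))) addnC leq_add2r.
apply: leq_trans (_ : #|vars_of G :|: [set i in us]| <= _)%N.
  apply: subset_leq_card; apply/subsetP => i; rewrite !inE negb_and !negbK.
  by [].
apply: leq_trans (leq_card_setU _ _) _; rewrite leq_add2l cardsE.
exact: card_size.
Qed.
End Units.
End Symmetry.

(** * Local structure of a sparse random formula *)

Section Local.
Variables (R : realFieldType) (n k : nat).
Local Notation clause := (clause n k).
Local Notation assignment := (assignment n).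
Implicit Types (c : clause) (F G H Q : {set clause}) (x y : assignment).
Implicit Types (U V A S : {set 'I_n}) (u v : 'I_n) (a b X : R).

Definition unsat F : R := (~~ satisfiable F)%:R.

Lemma satisfiable_satp F : satisfiable F = satp predT F.
Proof. by []. Qed.

(** The strict inequality leaves one variable to spare, so that Hall's condition survives fixing
    [v]. *)
Definition expanding Q : bool :=
  [forall P : {set clause}, (P \subset Q) ==> (P != set0) ==> (#|P| < #|vars_of P|)%N].

Definition good (s m : nat) v G : bool :=
  [&& (#|component G v| < s)%N, expanding (component G v) & (#|G| < m)%N].

Lemma unsat_mono F G : F \subset G -> unsat F <= unsat G.
Proof.
move=> FG; rewrite /unsat ler_nat; have := @satpS n k predT _ _ FG.
rewrite -!satisfiable_satp.
by case: (satisfiable G) => [/(_ isT) ->|]; case: (satisfiable F).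
Qed.

Lemma diff_unsat_ge0 c F : 0 <= ddiff c unsat F.
Proof.
by rewrite subr_ge0 unsat_mono // (subset_trans (subsetDl _ _)) // subsetUr.
Qed.

Lemma diff_unsat_le1 c F : ddiff c unsat F <= 1.
Proof.
rewrite /ddiff /unsat; do 2!case: satisfiable;
  by rewrite /= ?subr0 ?subrr ?sub0r //; lra.
Qed.

(* The component of [v] has a solution making [c] true at [v]; after fixing it,
   [v] and its component are isolated in what remains of [G]. *)
Lemma expect_diff_unsat_le b X s m m' c v G : (0 < k)%N -> 0 < b < 1 -> 0 <= X ->
  #|{: clause}|%:R / (b * (1 - b)) <= X ^+ 2 -> (k <= m)%N ->
  (2 * (k * m' + (1 + k * s)) <= n)%N -> v \in vars c -> good s m' v G ->
  expect b (fun H => ddiff c unsat (G :|: H)) <=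
  b + (1 + k * s)%:R * (m%:R / n%:R + X / 'C(m, k)%:R).
Proof.
move=> k0 hb X0 hX km small vc /and3P[Ts /forallP exT Gm].
have hb' : 0 <= b <= 1 by case/andP: hb => /ltW-> /ltW->.
move: (vc); rewrite inE; case Ec: (val c v) => [e|] // _.
set T := component G v in Ts exT; pose U := v |: vars_of T.
have TU : T = G :&: touching k U by rewrite component_fix.
(* The value [~~ e] at [v] makes [c] true; the rest of [tau] satisfies the component. *)
have [P PT|tau tauv satT] := @hall_satisfies n k T [set v] [ffun=> ~~ e].
  have [->|P0] := eqVneq P set0; first by rewrite cards0.
  have := exT P; rewrite PT P0 /= (cardsD1 v (vars_of P)).
  by case: (v \in _); rewrite ?add1n ?add0n ?ltnS // => /ltnW.
have {}tauv : tau v = ~~ e by rewrite tauv ?inE // ffunE.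
pose G' := G :\: T; pose us := enum U.
have G'U : [disjoint vars_of G' & U].
  rewrite disjoints_subset; apply/bigcupsP => d; rewrite inE => /andP[dT dG].
  by rewrite -disjoints_subset; apply: contraR dT => dU; rewrite TU !inE dG.
have szU : (size us <= 1 + k * s)%N.
  rewrite -cardE cardsU1 leq_add ?leq_b1 // (leq_trans (card_vars_of _)) //.
  by rewrite leq_mul2l ltnW ?orbT.
have del0 : 0 <= m%:R / n%:R + X / 'C(m, k)%:R by rewrite addr_ge0 // divr_ge0.
(* If [c] is pivotal and not in [H], then [G' :|: H] is satisfiable, but not by an assignment equal
   to [tau] on [U]: such an assignment would satisfy [c] and all of [F]. *)
apply: (@le_trans _ _ (expect b (fun H => (c \in H)%:R +
    (satp predT (G' :|: H) && ~~ satp (agree tau us) (G' :|: H))%:R))).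
  apply: ler_expect => // H; set F := G :|: H.
  have [cH|cH] := boolP (c \in H).
    by rewrite (le_trans (diff_unsat_le1 _ _)) // lerDl ler0n.
  rewrite add0r /ddiff /unsat !satisfiable_satp.
  have [sat|_] := boolP (satp predT (F :\ c)); last first.
    by apply: (@le_trans _ _ 0); rewrite ?ler0n // subr_le0 lern1 leq_b1.
  rewrite subr0 ler_nat; case: (boolP (satp predT (c |: F))) => // ns.
  rewrite lt0b; apply/andP; split.
    apply: satpS sat; apply/subsetP => d; rewrite !inE => dGH.
    (* [c] is not in [G'], since every clause of [G] containing [v] belongs to [T]. *)
    have -> : d != c.
      apply: contraTneq dGH => ->; rewrite negb_or cH andbT negb_and negbK.
      rewrite orbC -implybE; apply/implyP => cG; rewrite TU !inE cG /=.
      by apply/pred0Pn; exists v; rewrite /= vc setU11.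
    by case/orP: dGH => [/andP[_ ->]|->] //; rewrite orbT.
  apply: contra ns => /satpP[y ay yGH]; apply/satpP; exists y => //.
  have yU : {in U, y =1 tau}.
    by move=> i iU; apply/eqP; move/allP: ay; apply; rewrite mem_enum.
  rewrite satisfiesU; apply/andP; split.
    apply/satisfiesP => d /set1P ->; apply/negP => /falsifies_val/(_ Ec).
    by rewrite yU ?setU11 // tauv; case: e {Ec tauv}.
  have : satisfies y (T :|: (G' :|: H)).
    rewrite satisfiesU yGH andbT (@eq_satisfies _ _ _ tau) // => i iT.
    by rewrite yU // inE iT orbT.
  by apply: satisfiesS; apply/subsetP => d; rewrite !inE; case: (d \in T).
rewrite expectD lerD //.
  rewrite (expect_eq _ (g2 := fun H => ([set c] \subset H)%:R)).
    by rewrite expect_subset cards1.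
  by move=> H; rewrite sub1set.
apply: (le_trans (expect_units_le tau k0 hb X0 hX km (us := us) _ _ _ _)).
- exact: enum_uniq.
- apply/allP => u; rewrite mem_enum => uU; apply: contraTN uU => uG.
  by rewrite (disjointFr G'U uG).
- exact: leq_ltn_trans (leq0n v) (ltn_ord v).
- apply: leq_trans small; rewrite leq_mul2l /= leq_add //.
  rewrite (leq_trans (card_vars_of _)) // leq_mul2l.
  by rewrite (leq_trans (subset_leq_card (subsetDl _ _))) ?orbT // ltnW.
by rewrite ler_wpM2r // ler_nat.
Qed.

Lemma touching1 v : touching k [set v] = [set c : clause | v \in vars c].
Proof. by apply/setP => c; rewrite !inE disjoint_sym disjoints1 negbK inE. Qed.

(** Transpositions show that all variables have the same degree; incidences are then counted in two
    ways. *)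
Lemma card_touching1 v : (n * #|touching k [set v]| = k * #|{: clause}|)%N.
Proof.
rewrite touching1; pose t u := #|[set c : clause | u \in vars c]|.
have le u u' : (t u <= t u')%N.
  rewrite /t -(card_imset _ (@act_clause_inj n k (tperm u u') (fun=> false))).
  apply: subset_leq_card; apply/subsetP => _ /imsetP[c + ->].
  by rewrite !inE SubK ffunE tpermR; case: (val c u).
have eq u : t u = t v by apply/eqP; rewrite eqn_leq !le.
transitivity (\sum_u t u)%N.
  by rewrite (eq_bigr _ (fun u _ => eq u)) sum_nat_const card_ord.
rewrite mulnC -sum_nat_const -[in RHS](eq_bigr _ (fun c _ => card_vars c)).
under eq_bigr do rewrite /t -sum1_card big_mkcond /=.
rewrite exchange_big; apply: eq_bigr => c _; rewrite -sum1_card [RHS]big_mkcond.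
by apply: eq_bigr => u _; rewrite inE.
Qed.

Lemma card_touching U v : (#|touching k U| <= #|U| * #|touching k [set v]|)%N.
Proof.
have eq u : #|touching k [set u]| = #|touching k [set v]|.
  apply/eqP; have n0 : (0 < n)%N by apply: leq_ltn_trans (leq0n v) (ltn_ord v).
  by rewrite -(eqn_pmul2l n0) !card_touching1.
have -> : touching k U = \bigcup_(u in U) touching k [set u].
  apply/setP => c; rewrite inE; apply/pred0Pn/bigcupP => [[u /andP[/= uc uU]]|[u uU]].
    by exists u => //; rewrite touching1 inE.
  by rewrite touching1 inE => uc; exists u; rewrite /= uc.
rewrite -sum_nat_const; elim/big_rec2: _ => [|u m V _ IH]; first by rewrite cards0.
by apply: leq_trans (leq_card_setU _ _) _; rewrite -(eq u) leq_add2l.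
Qed.

(* Compare the law of the component at density [a] with its law at the density
   [a1], which is still subcritical: each realization of the component gains
   at least the factor [(a1 / (2 * a)) ^ #|Q| / 2]. *)
Lemma expect_component_ge a a1 s v : 0 <= a -> 2 * a <= a1 -> 0 < a1 < 1 -> (0 < k)%N ->
  1 / 2 <= (1 - a1) ^+ (k * #|touching k [set v]|) ->
  expect a (fun G => (s <= #|component G v|)%:R) <= 2 * (2 * a / a1) ^+ s.
Proof.
move=> a0 aa1 /andP[a10 a11] k0.
have ha : 0 <= a <= 1 by lra.
have ha1 : 0 <= a1 <= 1 by rewrite !ltW.
have q0 : 0 <= 1 - a by lra.
have q1 : 1 - a <= 1 by lra.
have q10 : 0 <= 1 - a1 by lra.
have q11 : 1 - a1 <= 1 by lra.
have h0 : 0 <= 1 / 2 :> R by lra.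
move=> half.
pose r := 2 * a / a1.
have r0 : 0 <= r by rewrite divr_ge0 ?mulr_ge0 // ltW.
have r1 : r <= 1 by rewrite ler_pdivrMr // mul1r.
pose N Q := touching k (v |: vars_of Q).
pose K := [set component G v | G : {set clause}].
have ind G : ((s <= #|component G v|)%N%:R : R) =
    \sum_(Q in K | (s <= #|Q|)%N) (G :&: N Q == Q)%:R.
  have inK : component G v \in K by apply: imset_f.
  rewrite big_mkcondr (bigD1 (component G v)) //= big1 ?addr0 => [|Q /andP[+ QG]].
    by rewrite /N component_fix eqxx; case: ifP.
  case/imsetP=> F _ QF; rewrite QF in QG *; rewrite -eq_component eq_sym.
  by rewrite (negbTE QG); case: ifP.
have sub Q : Q \in K -> Q \subset N Q by case/imsetP=> F _ ->; apply: component_touching.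
(* The events that the component is [Q] are disjoint, so their probabilities at density [a1] sum to
   at most one. *)
have one : \sum_(Q in K) a1 ^+ #|Q| * (1 - a1) ^+ (#|N Q| - #|Q|) <= 1.
  apply: (@le_trans _ _ (\sum_(Q in K) expect a1 (fun G => (G :&: N Q == Q)%:R))).
    by apply: ler_sum => Q QK; rewrite expect_setI // sub.
  rewrite -expect_sum; apply: expect_le1 => // G.
  rewrite (bigD1 (component G v)) /=; last exact: imset_f.
  rewrite big1 => [|Q /andP[/imsetP[F _ ->] QG]]; first by rewrite addr0 lern1 leq_b1.
  by rewrite -eq_component eq_sym (negbTE QG).
have step Q : Q \in K -> (s <= #|Q|)%N -> expect a (fun G => (G :&: N Q == Q)%:R) <=
    2 * r ^+ s * (a1 ^+ #|Q| * (1 - a1) ^+ (#|N Q| - #|Q|)).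
  move=> QK sQ; rewrite expect_setI ?sub //.
  apply: (@le_trans _ _ (a ^+ #|Q|)).
    by rewrite ler_piMr ?exprn_ge0 // exprn_ile1.
  have -> : a ^+ #|Q| = r ^+ #|Q| * a1 ^+ #|Q| * (1 / 2) ^+ #|Q|.
    rewrite -!exprMn; congr (_ ^+ _); rewrite /r; field.
    by rewrite gt_eqF.
  (* [N Q] has at most [1 + k * #|Q|] times the degree of [v] clauses, and
     [1 + k * #|Q| <= k * (1 + #|Q|)]. *)
  have h : (1 / 2) ^+ (1 + #|Q|) <= (1 - a1) ^+ (#|N Q| - #|Q|).
    apply: (@le_trans _ _ ((1 - a1) ^+ (k * #|touching k [set v]| * (1 + #|Q|)))).
      by rewrite exprM; apply: lerXn2r; rewrite ?nnegrE ?exprn_ge0.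
    apply: ler_wiXn2l => //; apply: leq_trans (leq_subr _ _) _.
    apply: leq_trans (card_touching _ v) _.
    rewrite mulnAC leq_mul2r (leq_trans (leq_card_setU _ _)) ?orbT // cards1.
    rewrite mulnDr muln1 leq_add //; exact: card_vars_of.
  rewrite -mulrA [leRHS]mulrA -[leRHS]mulrA.
  have rs : r ^+ #|Q| <= r ^+ s by apply: ler_wiXn2l.
  apply: (@le_trans _ _ (r ^+ s * (a1 ^+ #|Q| * (1 / 2) ^+ #|Q|))).
    by rewrite ler_wpM2r // mulr_ge0 // exprn_ge0 // ltW.
  rewrite [2 * _]mulrC -mulrA; apply: ler_wpM2l; first exact: exprn_ge0.
  rewrite mulrCA; apply: ler_wpM2l; first by rewrite exprn_ge0 // ltW.
  by move: h; rewrite exprD expr1 -ler_pdivrMl // div1r.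
have -> : expect a (fun G => (s <= #|component G v|)%:R) =
    \sum_(Q in K | (s <= #|Q|)%N) expect a (fun G => (G :&: N Q == Q)%:R).
  by rewrite -expect_sum; apply: expect_eq => G; rewrite -ind.
apply: (@le_trans _ _ (\sum_(Q in K | (s <= #|Q|)%N)
  2 * r ^+ s * (a1 ^+ #|Q| * (1 - a1) ^+ (#|N Q| - #|Q|)))).
  by apply: ler_sum => Q /andP[QK sQ]; apply: step.
rewrite -mulr_sumr ler_piMr ?mulr_ge0 ?exprn_ge0 //.
apply: le_trans one; rewrite big_mkcondr; apply: ler_sum => Q _.
by case: ifP => // _; rewrite mulr_ge0 // exprn_ge0 // ltW.
Qed.

Lemma leq_ffact_exp m i : (m ^_ i <= m ^ i)%N.
Proof.
have -> : (m ^ i = \prod_(j < i) m)%N by rewrite prod_nat_const card_ord.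
rewrite ffact_prod.
by apply: leq_prod => j _; apply: leq_subr.
Qed.

Lemma leq_bin_exp m i : ('C(m, i) <= m ^ i)%N.
Proof.
apply: leq_trans (leq_ffact_exp m i); rewrite -bin_ffact.
by rewrite leq_pmulr ?fact_gt0.
Qed.

(** A clause is determined by its graph, a [k]-subset of the product of [U] with the booleans. *)
Lemma card_clauses_in U :
  (#|[set c : clause | vars c \subset U]| <= (2 * #|U|) ^ k)%N.
Proof.
pose g c := [set z : 'I_n * bool | val c z.1 == Some z.2].
have gE c i e : ((i, e) \in g c) = (val c i == Some e) by rewrite inE.
have g_inj : injective g.
  move=> c d cd; apply/val_inj/ffunP => i.
  have E e : (val c i == Some e) = (val d i == Some e) by rewrite -!gE cd.
  case Ei: (val c i) => [e|]; first by apply/esym/eqP; rewrite -E Ei.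
  by case Ed: (val d i) => [e|] //; have := E e; rewrite Ei Ed eqxx.
apply: leq_trans (leq_bin_exp _ _).
have <- : #|setX U [set: bool]| = (2 * #|U|)%N by rewrite cardsX cardsT card_bool mulnC.
rewrite -cards_draws -(card_imset _ g_inj); apply: subset_leq_card.
apply/subsetP => _ /imsetP[c + ->]; rewrite inE => /subsetP cU.
rewrite inE; apply/andP; split.
  apply/subsetP => -[i e]; rewrite gE in_setX inE andbT => /eqP ib.
  by apply: cU; rewrite inE ib.
rewrite -(card_vars c) -(card_in_imset (f := fst) (D := mem (g c))).
  apply/eqP/eq_card => i; apply/imsetP/idP => [[[j e] + ->]|].
    by rewrite gE inE => /eqP ->.
  by rewrite inE; case E: (val c i) => [e|] // _; exists (i, e); rewrite ?gE ?E.
move=> [i e] [j e']; rewrite !gE /= => /eqP ib /eqP jb ij.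
by move: jb; rewrite -ij ib => -[->].
Qed.

(** Union bound: a violating set contains [i] clauses on some set of [i] variables, where
    [k <= i < s] since one clause already has [k] variables. Choosing the variables and the clauses
    gives at most [y ^ i]. *)
Lemma expect_nonexpanding a (s : nat) v : 0 <= a <= 1 -> (0 < k)%N ->
  n%:R * (2 * s)%:R ^+ k * a <= 1 ->
  expect a (fun G => ((#|component G v| < s)%N && ~~ expanding (component G v))%:R)
  <= s%:R * (n%:R * (2 * s)%:R ^+ k * a) ^+ k.
Proof.
move=> ha k0; set y := _ * a => y1; have /andP[a0 a1] := ha.
have y0 : 0 <= y by rewrite !mulr_ge0 ?exprn_ge0.
pose B (i : 'I_s) U Q := [&& #|U| == i, vars_of Q \subset U & #|Q| == i].
apply: (@le_trans _ _ (expect a (fun G => \sum_(i < s | (k <= i)%N)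
    \sum_(U : {set 'I_n}) \sum_(Q | B i U Q) (Q \subset G)%:R))).
  apply: ler_expect => // G.
  have sum0 : 0 <= \sum_(i < s | (k <= i)%N)
      \sum_(U : {set 'I_n}) \sum_(Q | B i U Q) (Q \subset G)%:R :> R.
    by do 3!apply: sumr_ge0 => ? _.
  have [/andP[ts]|//] := boolP ((#|component G v| < s)%N && _).
  rewrite negb_forall => /existsP[P]; rewrite !negb_imply -leqNgt.
  move=> /and3P[PT P0 VP].
  have Ps : (#|P| < s)%N := leq_ltn_trans (subset_leq_card PT) ts.
  pose i := Ordinal (leq_ltn_trans VP Ps).
  have [Q] : exists Q, Q \in [set Q : {set clause} | (Q \subset P) && (#|Q| == i)].
    by apply/set0Pn; rewrite -card_gt0 cards_draws bin_gt0.
  rewrite inE => /andP[QP Qi].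
  have ki : (k <= i)%N.
    have /set0Pn[c cP] := P0; rewrite -(card_vars c) /=.
    exact: subset_leq_card (vars_sub cP).
  rewrite (bigD1 i) //= (bigD1 (vars_of P)) //= (bigD1 Q) /=; last first.
    by rewrite /B eqxx Qi vars_ofS.
  have -> : Q \subset G := subset_trans QP (subset_trans PT (component_sub _ _)).
  rewrite -!addrA lerDl; apply: addr_ge0; first by apply: sumr_ge0.
  apply: addr_ge0; first by do 2!apply: sumr_ge0 => ? _.
  by do 3!apply: sumr_ge0 => ? _.
rewrite expect_sum; apply: (@le_trans _ _ (\sum_(i < s | (k <= i)%N) y ^+ k)).
  apply: ler_sum => i ki.
  apply: (@le_trans _ _ (y ^+ i)); last by apply: ler_wiXn2l.
  rewrite expect_sum; apply: (@le_trans _ _ (\sum_(U : {set 'I_n} | #|U| == i)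
      ((2 * s)%:R ^+ k * a) ^+ i)).
    rewrite [leRHS]big_mkcond; apply: ler_sum => U _; case: ifP => Ui; last first.
      rewrite (expect_eq _ (g2 := fun=> 0)) ?expect_cst // => G.
      by rewrite big_pred0 // => Q; rewrite /B Ui.
    rewrite expect_sum (eq_bigr (fun=> a ^+ i)) => [|Q /and3P[_ _ /eqP Qi]]; last first.
      by rewrite expect_subset Qi.
    rewrite sumr_const -[leLHS]mulr_natl exprMn ler_wpM2r ?exprn_ge0 //.
    rewrite -!natrX ler_nat.
    apply: (@leq_trans 'C(#|[set c : clause | vars c \subset U]|, i)).
      rewrite -cards_draws; apply: subset_leq_card; apply/subsetP => Q.
      rewrite !inE => /and3P[_ QU ->]; rewrite andbT; apply/subsetP => c cQ.
      by rewrite inE (subset_trans (vars_sub cQ)).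
    apply: leq_trans (leq_bin_exp _ _) _.
    case: i {B} ki Ui => [[|i] /= is_] ki Ui; first by rewrite !expn0.
    rewrite leq_exp2r // (leq_trans (card_clauses_in U)) //.
    by rewrite leq_exp2r // leq_mul2l (eqP Ui) ltnW.
  have -> : y ^+ i = n%:R ^+ i * ((2 * s)%:R ^+ k * a) ^+ i.
    by rewrite -exprMn mulrA.
  rewrite sumr_const -[leLHS]mulr_natl ler_wpM2r //.
    by rewrite exprn_ge0 // mulr_ge0 ?exprn_ge0.
  rewrite -natrX ler_nat -[X in (_ <= X ^ _)%N](card_ord n).
  apply: leq_trans (leq_bin_exp _ _); rewrite -card_draws.
  by apply: subset_leq_card; apply/subsetP => U; rewrite inE.
apply: (@le_trans _ _ (\sum_(i < s) y ^+ k)).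
  rewrite big_mkcond; apply: ler_sum => i _; case: ifP => // _; exact: exprn_ge0.
by rewrite sumr_const card_ord mulr_natl.
Qed.

(** Markov's inequality for the number of [s]-subsets of [G]. *)
Lemma expect_card_ge a s m : 0 <= a <= 1 -> (s <= m)%N ->
  expect a (fun G : {set clause} => (m <= #|G|)%:R) <=
  'C(#|{: clause}|, s)%:R * a ^+ s / 'C(m, s)%:R.
Proof.
move=> ha sm; have C0 : 0 < 'C(m, s)%:R :> R by rewrite ltr0n bin_gt0.
rewrite ler_pdivlMr // mulrC -expectZ.
have -> : 'C(#|{: clause}|, s)%:R * a ^+ s =
    expect a (fun G => \sum_(Q : {set clause} | #|Q| == s) (Q \subset G)%:R).
  rewrite expect_sum (eq_bigr (fun=> a ^+ s)) => [|Q /eqP Qs]; last first.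
    by rewrite expect_subset Qs.
  rewrite sumr_const -[RHS]mulr_natl -card_draws; congr (_%:R * _).
  by apply: eq_card => Q; rewrite inE.
apply: ler_expect => // G; have [mG|_] := leqP m #|G|; last first.
  by rewrite mulr0 sumr_ge0.
rewrite mulr1 -natr_sum ler_nat -big_mkcondr /= sum1_card.
apply: leq_trans (leq_bin2l s mG) _; rewrite -cards_draws.
by apply: subset_leq_card; apply/subsetP => Q; rewrite !inE andbC.
Qed.
End Local.

(** * Variance and total influence *)

Section Influence.
Variables (R : realFieldType) (n k : nat).
Local Notation clause := (clause n k).
Local Notation N := #|{: clause}|.
Implicit Types (c : clause) (F G H Q : {set clause}).
Local Notation unsat := (@unsat R n k).

Lemma expect_bad_le (a a1 : R) (s m : nat) v : (0 < k)%N ->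
  0 <= a -> 2 * a <= a1 -> 0 < a1 < 1 ->
  1 / 2 <= (1 - a1) ^+ (k * #|touching k [set v]|) ->
  n%:R * (2 * s)%:R ^+ k * a <= 1 -> (s <= m)%N ->
  expect a (fun G => (~~ good s m v G)%:R) <=
  2 * (2 * a / a1) ^+ s + s%:R * (n%:R * (2 * s)%:R ^+ k * a) ^+ k +
  'C(N, s)%:R * a ^+ s / 'C(m, s)%:R.
Proof.
move=> k0 a0 aa1 ha1 half y1 sm.
have ha : 0 <= a <= 1 by clear half; lra.
apply: (@le_trans _ _ (expect a (fun G => (s <= #|component G v|)%:R +
  ((#|component G v| < s)%N && ~~ expanding (component G v))%:R +
  (m <= #|G|)%:R))).
  apply: ler_expect => // G; rewrite -!natrD ler_nat /good !negb_and -!leqNgt.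
  rewrite [(_ < s)%N]ltnNge.
  by case: (s <= _)%N; case: (expanding _); case: (m <= _)%N.
rewrite !expectD; apply: lerD; last exact: expect_card_ge.
by apply: lerD; [apply: expect_component_ge|apply: expect_nonexpanding].
Qed.

(** For fixed [G] the mean over [H] of the derivative lies in [[0, 1]]. Its square is at most [D]
    times itself when [G] is good around a variable of the clause, and at most [1] otherwise;
    summing gives [D * I] plus the bad probability. *)
Lemma variance_unsat_le (p a b a1 X : R) (d s m m' : nat)
    (I := p * (1 - p) * \sum_c expect p (ddiff c unsat))
    (bad := 2 * (2 * a / a1) ^+ s + s%:R * (n%:R * (2 * s)%:R ^+ k * a) ^+ k +
            'C(N, s)%:R * a ^+ s / 'C(m', s)%:R) :
  (0 < k)%N -> (0 < d)%N -> p = a + b - a * b ->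
  0 < p < 1 -> 0 < a -> a <= p -> 0 < b < 1 ->
  2 * a <= a1 -> 0 < a1 < 1 ->
  (forall v : 'I_n, 1 / 2 <= (1 - a1) ^+ (k * #|touching k [set v]|)) ->
  n%:R * (2 * s)%:R ^+ k * a <= 1 -> (s <= m')%N ->
  0 <= X -> N%:R / (b * (1 - b)) <= X ^+ 2 -> (k <= m)%N ->
  (2 * (k * m' + (1 + k * s)) <= n)%N ->
  expect p unsat - expect p unsat ^+ 2 <= I / d%:R +
  (a * (1 - p) / (p * (1 - a))) ^- d *
  ((b + (1 + k * s)%:R * (m%:R / n%:R + X / 'C(m, k)%:R)) * I + p * N%:R * bad).
Proof.
move=> k0 d0 pE hp a0 ap hb aa1 ha1 half y1 sm' X0 hX km small.
have hp' : 0 <= p <= 1 by case/andP: hp => /ltW-> /ltW->.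
have hb' : 0 <= b <= 1 by case/andP: hb => /ltW-> /ltW->.
have ha' : 0 <= a <= 1 by rewrite (ltW a0) (le_trans ap) //; case/andP: hp'.
have v0 : 0 <= p * (1 - p) by case/andP: hp' => ? ?; rewrite mulr_ge0 // subr_ge0.
have x0 : 0 <= (a * (1 - p) / (p * (1 - a))) ^- d.
  case/andP: hp' ha' => p0 p1 /andP[_ a1'].
  by rewrite invr_ge0 exprn_ge0 // divr_ge0 // mulr_ge0 ?subr_ge0 // ltW.
have := variance_le unsat pE hp a0 ap d0.
have -> : expect p (fun F => unsat F ^+ 2) = expect p unsat.
  by apply: expect_eq => F; rewrite /unsat; case: (~~ _); rewrite ?expr1n ?expr0n.
move=> /le_trans; apply; apply: lerD.
  apply: ler_wpM2r; first by rewrite invr_ge0.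
  apply: ler_wpM2l => //; apply: ler_sum => c _; apply: ler_expect => // F.
  by rewrite expr2 ler_piMr ?diff_unsat_ge0 ?diff_unsat_le1.
apply: ler_wpM2l => //; set D := b + _.
have D0 : 0 <= D.
  case/andP: hb' => b0 _; rewrite addr_ge0 // mulr_ge0 // addr_ge0 // divr_ge0 //.
have [p0 p1] := andP hp'; have [a0' a1'] := andP ha'; have [a10 _] := andP ha1.
have bad0 : 0 <= bad.
  rewrite !addr_ge0 ?mulr_ge0 ?exprn_ge0 ?invr_ge0 ?mulr_ge0 ?exprn_ge0 //.
  by rewrite invr_ge0 ltW.
apply: (@le_trans _ _ (p * (1 - p) *
    \sum_c (D * expect p (ddiff c unsat) + bad))); last first.
  rewrite big_split /= -mulr_sumr sumr_const -[bad *+ _]mulr_natl mulrDr /I.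
  rewrite (mulrCA _ D) lerD2l mulrA ler_wpM2r // ler_wpM2r //.
  by rewrite ler_piMr // gerBl.
apply: ler_wpM2l => //; apply: ler_sum => c _.
have [v vc] : exists v, v \in vars c.
  by apply/set0Pn; rewrite -card_gt0 card_vars.
apply: le_trans (_ : _ <= D * expect p (ddiff c unsat) +
    expect a (fun G => (~~ good s m' v G)%:R)) _; last first.
  by rewrite lerD2l; apply: expect_bad_le.
rewrite [X in D * expect X _]pE -expect_union -expectZ -expectD.
apply: ler_expect => // G; set be := expect b _.
have be0 : 0 <= be by apply: expect_ge0 => // H; apply: diff_unsat_ge0.
have be1 : be <= 1 by apply: expect_le1 => // H; apply: diff_unsat_le1.
have [gd|_] := boolP (good s m' v G).
  rewrite addr0 expr2 ler_wpM2r //.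
  exact: (expect_diff_unsat_le k0 hb X0 hX km small vc gd).
by rewrite ler_wpDl ?mulr_ge0 // expr_le1.
Qed.
End Influence.

(** * Choice of the parameters *)

Lemma leq_exp_ffact m i : ((m - i) ^ i <= m ^_ i)%N.
Proof.
have -> : ((m - i) ^ i = \prod_(j < i) (m - i))%N by rewrite prod_nat_const card_ord.
rewrite ffact_prod; apply: leq_prod => j _.
by apply: leq_sub2l; apply: ltnW.
Qed.

Lemma leq_bin_exp2 m i : ('C(m, i) <= 2 ^ m)%N.
Proof.
rewrite -[X in 'C(X, _)](card_ord m) -card_draws -[X in (2 ^ X)%N](card_ord m).
by rewrite -cardsT -card_powerset; apply: subset_leq_card; rewrite powersetT subsetT.
Qed.

Lemma exp2_dominates c j : exists M0, forall M, (M0 <= M)%N -> (c * M ^ j <= 2 ^ M)%N.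
Proof.
pose K := (2 ^ j.+1 * j.+1`!)%N.
have K0 : (0 < K)%N by rewrite muln_gt0 expn_gt0 fact_gt0.
exists (2 * j.+1 + c * K)%N => M hM.
rewrite -(leq_pmul2l K0); apply: (@leq_trans (M ^ j.+1)).
  by rewrite mulnA [(K * c)%N]mulnC expnS leq_mul2r; apply/orP; right; lia.
apply: (@leq_trans ((2 * (M - j.+1)) ^ j.+1)).
  by rewrite leq_exp2r //; lia.
rewrite expnMn /K -mulnA leq_mul2l; apply/orP; right.
apply: leq_trans (leq_exp_ffact _ _) _.
by rewrite -bin_ffact mulnC leq_mul2l leq_bin_exp2 orbT.
Qed.

Section LargeN.
Variables (R : realFieldType) (n k M Cv : nat).
Hypothesis k3 : (3 <= k)%N.
Local Notation clause := (clause n k).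
Local Notation N := #|{: clause}|.
Local Notation unsat := (@unsat R n k).

(* Everything is measured in powers of [z], which is of order [n ^ (1 / Q)], while
   [M] is of order [log n].  The sparse part has density [a = p / 2 ^ r], low
   enough for [s] clauses in a component to have probability [z ^- (Q + r + 3)],
   hence negligible against the loss [z ^ (r + 1)] of the noise operator at level
   [M] times the number of order [z ^ Q] of clauses of the formula.  A proportion
   [z ^- h] of frozen variables is what unit constraints can be charged to, and
   [Q] makes [sqrt (M / n)] smaller than the proportion [z ^- (h * k)] of clauses
   on such variables. *)
Let r := (3 * k + 4)%N.
Let h := (r + 4)%N.
Let Q := (2 * (h * k + h + 1))%N.
Let s := ((Q + r + 3) * M)%N.
Let K := (2 ^ k.+1 * k`!)%N.
Let z := (2 ^ M)%N.

Hypothesis M0 : (0 < M)%N.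
Hypothesis zn : (z ^ Q <= n)%N.
Hypothesis nz : (n <= 2 ^ Q * z ^ Q)%N.
Hypothesis z_delta : (1 + (1 + k * s) * (1 + 2 * 8 ^ k) <= z ^ 2)%N.
Hypothesis z_k : (16 * k * (1 + k * s) <= z)%N.
Hypothesis z_K : (2 * K <= z)%N.
Hypothesis z_s : (s.+1 * (K * (2 * s) ^ k) ^ 3 <= z)%N.
Hypothesis z_Cv : (Cv * 2 ^ (k + Q + 3) <= z)%N.

Let k0 : (0 < k)%N. Proof. exact: leq_trans k3. Qed.
Let z0 : (0 < z)%N. Proof. by rewrite expn_gt0. Qed.
Let Mz : (M <= z)%N. Proof. by rewrite ltnW // ltn_expl. Qed.

Let z_n : (z <= n)%N.
Proof.
apply: leq_trans zn; rewrite -[X in (X <= _)%N]expn1.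
by rewrite leq_pexp2l // /Q muln_gt0 /= addn1.
Qed.

Let n0 : (0 < n)%N. Proof. exact: leq_trans z0 z_n. Qed.

(** The factor [2 ^ k] from the signs makes up for [n - k] in place of [n], as [2 * k <= n]. *)
Let N_lb : (n ^ k <= k`! * N)%N.
Proof.
rewrite card_clause /num_clauses mulnCA [(k`! * _)%N]mulnC bin_ffact.
apply: leq_trans (_ : 2 ^ k * (n - k) ^ k <= _)%N; last first.
  by rewrite leq_mul2l leq_exp_ffact orbT.
rewrite -expnMn leq_exp2r //.
have : (2 * k <= n)%N.
  apply: leq_trans z_n; apply: leq_trans z_k; rewrite -[X in (X <= _)%N]muln1.
  by apply: leq_mul; rewrite ?leq_mul2r ?orbT.
by move: k0; clear; lia.
Qed.

Let N0 : (0 < N)%N.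
Proof.
have := leq_trans _ N_lb; move/(_ 1%N); rewrite expn_gt0 n0 muln_gt0.
by move=> /(_ isT)/andP[].
Qed.

Section Density.
Variable p : R.
Hypothesis p_lb : n%:R / (N%:R * M%:R) <= p.
Hypothesis p_ub : p <= (2 ^ k.+1)%:R * n%:R / N%:R.

Let n0R : 0 < n%:R :> R. Proof. by rewrite ltr0n. Qed.
Let N0R : 0 < N%:R :> R. Proof. by rewrite ltr0n. Qed.
Let M0R : 0 < M%:R :> R. Proof. by rewrite ltr0n. Qed.
Let z0R : 0 < z%:R :> R. Proof. by rewrite ltr0n. Qed.

Let p0 : 0 < p.
Proof. by apply: lt_le_trans p_lb; rewrite divr_gt0 ?mulr_gt0. Qed.

(** [p] is at most of order [n / N], and [3 <= k] gives [n ^ 3 <= n ^ k], which is at most a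
    constant times [N]. *)
Let pn2 : p * n%:R ^+ 2 <= K%:R.
Proof.
apply: le_trans (ler_wpM2r _ p_ub) _; first exact: exprn_ge0.
rewrite mulrAC ler_pdivrMr // -mulrA -exprS -!natrX -!natrM ler_nat /K.
rewrite -mulnA leq_mul2l; apply/orP; right; apply: leq_trans N_lb.
by rewrite leq_pexp2l.
Qed.

Let pn : p * n%:R <= 1 / 2.
Proof.
have hK : K%:R <= n%:R / 2 :> R.
  rewrite ler_pdivlMr // -natrM ler_nat mulnC; exact: leq_trans z_K z_n.
rewrite -(ler_pM2r n0R) -mulrA -expr2 (le_trans pn2) // (le_trans hK) //.
by rewrite mulrC div1r.
Qed.

Let p12 : p <= 1 / 2.
Proof.
apply: le_trans pn; rewrite ler_peMr ?(ltW p0) //.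
by rewrite ler1n.
Qed.

Let a := p / (2 ^ r)%:R.
Let b := (p - a) / (1 - a).
Let r0R : 0 < (2 ^ r)%:R :> R. Proof. by rewrite ltr0n expn_gt0. Qed.

Let a0 : 0 < a. Proof. exact: divr_gt0. Qed.

Let a2p : a <= p / 2.
Proof.
rewrite /a ler_wpM2l ?(ltW p0) // lef_pV2 ?posrE // ler_nat.
by rewrite -[X in (X <= _)%N]expn1 leq_pexp2l // /r addn4.
Qed.

Let b_lb : p / 2 <= b.
Proof.
have ? := a2p; have ? := p12; have ? := a0.
rewrite /b ler_pdivlMr; nra.
Qed.

Let b_ub : b <= p.
Proof.
have ? := a2p; have ? := p12; have ? := a0.
rewrite /b ler_pdivrMr; nra.
Qed.

Let pE : p = a + b - a * b.
Proof.
have ? := a2p; have ? := p12; have ? := a0.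
by rewrite /b; field; lra.
Qed.

Let b01 : 0 < b < 1.
Proof. by have ? := b_lb; have ? := b_ub; have ? := p0; have ? := p12; lra. Qed.

Let leqz e : (e <= Q)%N -> (z ^ e <= n)%N.
Proof. by move=> eQ; apply: leq_trans zn; rewrite leq_pexp2l. Qed.

(** [X] dominates [sqrt (N / (b * (1 - b)))], yet [X / 'C(m, k)] is still of order [z ^- h], because
    [N] is at most [(8 * z ^ h) ^ k * 'C(m, k)]. *)
Let X : R := 2 * N%:R / z%:R ^+ (h * k + h).

Let X0 : 0 <= X.
Proof. by rewrite divr_ge0 ?mulr_ge0 ?exprn_ge0. Qed.

Let X_lb : N%:R / (b * (1 - b)) <= X ^+ 2.
Proof.
have bb : p / 4 <= b * (1 - b).
  by have ? := b_lb; have ? := b_ub; have ? := p0; have ? := p12; nra.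
set W : R := z%:R ^+ (h * k + h) ^+ 2.
have W0 : 0 < W by rewrite !exprn_gt0.
have WNp : W <= N%:R * p.
  apply: (@le_trans _ _ (n%:R / M%:R)).
    rewrite ler_pdivlMr // /W -exprM -natrX -natrM ler_nat.
    apply: leq_trans zn; rewrite /Q.
    have -> : (2 * (h * k + h + 1) = (h * k + h) * 2 + 2)%N by ring.
    rewrite expnD leq_mul2l; apply/orP; right.
    by apply: leq_trans Mz _; rewrite -[X in (X <= _)%N]expn1 leq_pexp2l.
  have -> : n%:R / M%:R = N%:R * (n%:R / (N%:R * M%:R)) :> R.
    by field; rewrite !gt_eqF.
  by rewrite ler_wpM2l.
have p40 : 0 < p / 4 by have ? := p0; lra.
rewrite ler_pdivrMr; last exact: lt_le_trans bb.
apply: (@le_trans _ _ (X ^+ 2 * (p / 4))); last by rewrite ler_wpM2l ?sqr_ge0.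
have -> : X ^+ 2 * (p / 4) = N%:R * (N%:R * p / W).
  by rewrite /X /W; field; rewrite expf_neq0 // gt_eqF.
by rewrite ler_peMr // ler_pdivlMr // mul1r.
Qed.

Let m := (n %/ z ^ h)%N.

Let n_le_m : (n <= 2 * m * z ^ h)%N /\ (2 * k <= m)%N.
Proof.
have km : (2 * k <= m)%N.
  rewrite leq_divRL ?expn_gt0 ?z0 //.
  apply: (@leq_trans (z ^ h.+1)); last by apply: leqz; rewrite /Q; move: k0; clear; nia.
  rewrite expnS leq_mul2r; apply/orP; right; apply: leq_trans z_k.
  rewrite -[X in (X <= _)%N]muln1; apply: leq_mul => //.
  by rewrite leq_mul2r; apply/orP; right.
split=> //; have := ltn_ceil n (_ : 0 < z ^ h)%N; rewrite expn_gt0 z0 => /(_ isT).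
move=> /ltnW/leq_trans; apply; rewrite leq_mul2r; apply/orP; right.
by move: km k0; rewrite -/m; clear; lia.
Qed.

Let km : (k <= m)%N.
Proof. by have [_] := n_le_m; apply: leq_trans; rewrite leq_pmull. Qed.

Let N_le_bin : (N <= (8 * z ^ h) ^ k * 'C(m, k))%N.
Proof.
have [nm m2k] := n_le_m.
have kf : (0 < k`!)%N by rewrite fact_gt0.
rewrite -(leq_pmul2r kf) -mulnA bin_ffact card_clause /num_clauses -mulnA bin_ffact.
apply: (@leq_trans (2 ^ k * (4 * z ^ h * (m - k)) ^ k)).
  rewrite leq_mul2l (leq_trans (leq_ffact_exp _ _)) ?orbT // leq_exp2r //.
  apply: leq_trans nm _; rewrite [leqRHS]mulnAC leq_mul2r; apply/orP; right.
  by move: m2k; clear; lia.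
have -> : (2 ^ k * (4 * z ^ h * (m - k)) ^ k = (8 * z ^ h) ^ k * (m - k) ^ k)%N.
  by rewrite -!expnMn; congr (_ ^ _)%N; ring.
by rewrite leq_mul2l leq_exp_ffact orbT.
Qed.

Let D := b + (1 + k * s)%:R * (m%:R / n%:R + X / 'C(m, k)%:R).

(** All terms are [O (z ^- h)]; the factors linear in [s] are absorbed by [z ^ 2], and
    [h = r + 4]. *)
Let D_ub : D <= (z%:R ^+ (r + 2))^-1.
Proof.
have zh0 : 0 < z%:R ^+ h :> R by rewrite exprn_gt0.
have C0 : 0 < 'C(m, k)%:R :> R by rewrite ltr0n bin_gt0 km.
have bz : b <= 1 / z%:R ^+ h.
  apply: le_trans b_ub _; rewrite ler_pdivlMr //.
  apply: (@le_trans _ _ (p * n%:R)).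
    rewrite ler_wpM2l ?(ltW p0) // -natrX ler_nat; apply: leqz.
    by rewrite /Q; clear; lia.
  by apply: le_trans pn _; lra.
have mz : m%:R / n%:R <= 1 / z%:R ^+ h :> R.
  rewrite ler_pdivrMr // mulrAC ler_pdivlMr // mul1r -natrX -natrM ler_nat.
  exact: leq_trunc_div.
have Xz : X / 'C(m, k)%:R <= (2 * 8 ^ k)%:R / z%:R ^+ h.
  rewrite ler_pdivrMr // /X exprD ler_pdivrMr ?mulr_gt0 ?exprn_gt0 //.
  have -> : (2 * 8 ^ k)%:R / z%:R ^+ h * 'C(m, k)%:R * (z%:R ^+ (h * k) * z%:R ^+ h)
     = 2 * ((8 ^ k)%:R * z%:R ^+ (h * k) * 'C(m, k)%:R) :> R.
    rewrite natrM; move: (z%:R ^+ h) zh0 (z%:R ^+ (h * k)) (8 ^ k)%:R => u u0 w t.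
    by field; rewrite gt_eqF.
  rewrite ler_wpM2l // -natrX -!natrM ler_nat.
  by rewrite expnM -expnMn.
have -> : (z%:R ^+ (r + 2))^-1 = z%:R ^+ 2 / z%:R ^+ h :> R.
  have -> : h = ((r + 2) + 2)%N by rewrite /h -addnA.
  by rewrite (exprD _ (r + 2)) invfM mulrCA divff ?mulr1 // expf_neq0 // gt_eqF.
apply: (@le_trans _ _ ((1 + (1 + k * s) * (1 + 2 * 8 ^ k))%:R / z%:R ^+ h)); last first.
  by rewrite ler_wpM2r ?invr_ge0 ?(ltW zh0) // -natrX ler_nat.
rewrite natrD natrM mulrDl lerD // -mulrA ler_wpM2l // natrD mulrDl lerD //.
Qed.

Variable v : 'I_n.
(** At this density, [k] times the degree of a variable times [a1] is [1 / 2], so Bernoulli's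
    inequality yields [half]. *)
Let a1 := n%:R / (2 * k%:R ^+ 2 * N%:R) : R.

Let kR : 0 < k%:R :> R. Proof. by rewrite ltr0n. Qed.

Let a10 : 0 < a1.
Proof. by rewrite divr_gt0 ?mulr_gt0 ?exprn_gt0. Qed.

Let deg_a1 (w : 'I_n) : (k * #|touching k [set w]|)%:R * a1 = 1 / 2.
Proof.
have := card_touching1 k w; move: #|touching k [set w]| => t wt.
have {wt} E : n%:R * t%:R = k%:R * N%:R :> R by rewrite -!natrM wt.
rewrite natrM; have -> : t%:R = k%:R * N%:R / n%:R :> R.
  by rewrite -E; field; rewrite gt_eqF.
by rewrite /a1; field; rewrite !gt_eqF.
Qed.

Let a1_12 : a1 <= 1 / 2.
Proof.
rewrite -(deg_a1 v) ler_peMl ?(ltW a10) // ler1n muln_gt0 k0 /=.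
have kN : (0 < k * N)%N by rewrite muln_gt0 k0 N0.
by move: kN; rewrite -(card_touching1 k v) muln_gt0 => /andP[].
Qed.

Let half (w : 'I_n) : 1 / 2 <= (1 - a1) ^+ (k * #|touching k [set w]|).
Proof.
have -> : 1 / 2 = 1 - (k * #|touching k [set w]|)%:R * a1 by rewrite deg_a1; lra.
have x0 := ltW a10; have x1 : a1 <= 1 by have ? := a1_12; lra.
elim: (k * _)%N => [|j IH]; first by rewrite mul0r subr0.
rewrite exprSr; apply: le_trans (ler_wpM2r _ IH); last by rewrite subr_ge0.
have j0 : 0 <= j%:R :> R by [].
by rewrite -natr1; nra.
Qed.

(** The choice [r = 3 * k + 4] comes from here: [2 ^ r = 2 ^ k.+1 * 8 * (2 ^ k) ^ 2], which exceeds
    [2 ^ k.+1 * 8 * k ^ 2]. *)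
Let aa1 : 2 * (2 * a / a1) <= 1.
Proof.
have -> : 2 * (2 * a / a1) = p * (8 * k%:R ^+ 2 * N%:R / n%:R / (2 ^ r)%:R).
  by rewrite /a /a1; field; rewrite !gt_eqF.
apply: le_trans (ler_wpM2r _ p_ub) _.
  by rewrite !mulr_ge0 ?exprn_ge0 ?invr_ge0 ?exprn_ge0.
have -> : (2 ^ k.+1)%:R * n%:R / N%:R *
    (8 * k%:R ^+ 2 * N%:R / n%:R / (2 ^ r)%:R) =
    (2 ^ k.+1 * (8 * k ^ 2))%:R / (2 ^ r)%:R :> R.
  by rewrite !natrM natrX; field; rewrite !gt_eqF.
rewrite ler_pdivrMr // mul1r ler_nat.
have -> : (2 ^ r = 2 ^ k.+1 * (8 * (2 ^ k) ^ 2))%N.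
  rewrite -expnM -[8%N]/(2 ^ 3)%N -!expnD /r; congr (2 ^ _)%N; clear; lia.
by rewrite leq_mul2l leq_mul2l leq_exp2r // ltnW ?orbT // ltn_expl.
Qed.

Let y := n%:R * (2 * s)%:R ^+ k * a.

Let y0 : 0 <= y.
Proof. by rewrite /y mulr_ge0 ?(ltW a0) // mulr_ge0 ?exprn_ge0. Qed.

Let yn : y * n%:R <= (K * (2 * s) ^ k)%:R.
Proof.
apply: (@le_trans _ _ ((2 * s)%:R ^+ k * (p * n%:R ^+ 2))).
  have -> : y * n%:R = (2 * s)%:R ^+ k * (a * n%:R ^+ 2) by rewrite /y; ring.
  rewrite ler_wpM2l ?exprn_ge0 // ler_wpM2r ?sqr_ge0 //.
  by have ? := a2p; have ? := p0; lra.
have -> : (K * (2 * s) ^ k)%:R = (2 * s)%:R ^+ k * K%:R :> R.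
  by rewrite (natrM _ K) (natrX _ (2 * s)) mulrC.
by apply: ler_wpM2l pn2; apply: exprn_ge0.
Qed.

Let As_z : (s * (K * (2 * s) ^ k) ^ 3 <= z)%N /\ (K * (2 * s) ^ k <= z)%N.
Proof.
move: z_s; move: (K * _)%N => A hA; split.
  by apply: leq_trans hA; rewrite leq_mul2r leqnSn orbT.
apply: leq_trans hA; case: A => // A; rewrite mulSn.
apply: leq_trans (leq_addr _ _); rewrite -[X in (X <= _)%N]expn1.
by rewrite leq_pexp2l.
Qed.

Let y1 : y <= 1.
Proof.
have [_ Az] := As_z; rewrite -(ler_pM2r n0R) mul1r (le_trans yn) // ler_nat.
exact: leq_trans Az z_n.
Qed.

(** [y * n] is polynomial in [M], so [s * y ^ 3] is at most [z / n ^ 3], and [n ^ 3] is at least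
    [z ^ (3 * Q)]. *)
Let bad2 : s%:R * y ^+ k <= 1 / z%:R ^+ (Q + r + 3).
Proof.
have [Az _] := As_z.
have yk : y ^+ k <= y ^+ 3 by apply: ler_wiXn2l.
apply: (@le_trans _ _ (s%:R * y ^+ 3)); first by rewrite ler_wpM2l.
rewrite ler_pdivlMr ?exprn_gt0 //.
apply: (@le_trans _ _ (s%:R * y ^+ 3 * (n%:R ^+ 3 / z%:R))).
  apply: ler_wpM2l; first by rewrite mulr_ge0 ?exprn_ge0.
  rewrite ler_pdivlMr // -exprSr -!natrX ler_nat.
  apply: leq_trans (_ : (z ^ Q) ^ 3 <= _)%N; last by rewrite leq_exp2r.
  by rewrite -expnM leq_pexp2l //; rewrite /Q /h; move: k0; clear; nia.
have -> : s%:R * y ^+ 3 * (n%:R ^+ 3 / z%:R) = s%:R * (y * n%:R) ^+ 3 / z%:R.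
  by field; rewrite gt_eqF.
rewrite ler_pdivrMr // mul1r.
apply: le_trans (_ : s%:R * (K * (2 * s) ^ k)%:R ^+ 3 <= _).
  rewrite ler_wpM2l //; apply: lerXn2r yn; rewrite nnegrE // mulr_ge0 //.
by rewrite -natrX -natrM ler_nat.
Qed.

Let two_s : (2 ^ s)%:R = z%:R ^+ (Q + r + 3) :> R.
Proof. by rewrite -natrX /z -expnM mulnC. Qed.

Let bad1 : 2 * (2 * a / a1) ^+ s <= 2 / z%:R ^+ (Q + r + 3).
Proof.
rewrite -two_s ler_wpM2l // natrX -exprVn; apply: lerXn2r; rewrite ?nnegrE ?invr_ge0 //.
  by apply: divr_ge0; [apply: mulr_ge0|]; rewrite ?ltW.
by have ? := aa1; lra.
Qed.

(** Fewer than [m'] clauses meet at most a quarter of the variables, while the expected size [N * a]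
    stays below [(m' - s) / 2]. *)
Let m' := (n %/ (4 * k))%N.

Let n_large : (16 * k * (1 + k * s) <= n)%N.
Proof. exact: leq_trans z_n. Qed.

Let m'_lb : (n <= 8 * k * (m' - s))%N /\ (s <= m')%N.
Proof.
have := ltn_ceil n (_ : 0 < 4 * k)%N; rewrite muln_gt0 k0 => /(_ isT).
move: n_large; rewrite -/m'; move: m' s k0; clear.
move=> m s k0 h1 h2; have sm : (s <= m)%N by rewrite leqNgt; apply/negP => ?; nia.
by split=> //; nia.
Qed.

Let small : (2 * (k * m' + (1 + k * s)) <= n)%N.
Proof.
have := leq_trunc_div n (4 * k); rewrite -/m'; move: n_large k0; move: m' s.
by clear=> m s; nia.
Qed.

Let bad3 : 'C(N, s)%:R * a ^+ s / 'C(m', s)%:R <= 1 / z%:R ^+ (Q + r + 3).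
Proof.
have [nm' sm'] := m'_lb.
have C0 : 0 < 'C(m', s)%:R :> R by rewrite ltr0n bin_gt0.
have -> : 1 / z%:R ^+ (Q + r + 3) = (1 / 2) ^+ s :> R.
  by rewrite expr_div_n expr1n -two_s natrX.
rewrite ler_pdivrMr //.
have ms0 : 0 < (m' - s)%:R :> R.
  by rewrite ltr0n; case: (m' - s)%N nm' => //; rewrite muln0 leqNgt n0.
have Na : N%:R * a <= (m' - s)%:R / 2.
  apply: (@le_trans _ _ ((2 ^ k.+1)%:R * n%:R / (2 ^ r)%:R)).
    rewrite /a mulrA ler_wpM2r ?invr_ge0 //.
    by rewrite mulrC -ler_pdivlMr.
  rewrite ler_pdivrMr // [leRHS]mulrAC ler_pdivlMr //.
  rewrite -!natrM ler_nat; apply: leq_trans (leq_mul (leq_mul (leqnn _) nm') (leqnn 2)) _.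
  have -> : (2 ^ r = 2 ^ k.+1 * (8 * (2 ^ k * 2 ^ k)))%N.
    rewrite -[8%N]/(2 ^ 3)%N -!expnD /r; congr (2 ^ _)%N; clear; lia.
  have k2 : (2 * k <= 2 ^ k * 2 ^ k)%N.
    apply: leq_mul; last by rewrite ltnW // ltn_expl.
    by rewrite -[X in (X <= _)%N]expn1 leq_pexp2l.
  move: (2 ^ k.+1)%N (m' - s)%N (2 ^ k * 2 ^ k)%N k2 => A B E k2.
  have -> : (A * (8 * k * B) * 2 = 8 * A * B * (2 * k))%N by ring.
  have -> : (B * (A * (8 * E)) = 8 * A * B * E)%N by ring.
  by rewrite leq_mul2l k2 orbT.
rewrite -(ler_pM2r (exprn_gt0 s ms0)).
apply: (@le_trans _ _ ((N%:R * a) ^+ s * 'C(m', s)%:R)).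
  rewrite (exprMn _ N%:R a) [leLHS]mulrAC [leRHS]mulrAC.
  apply: ler_wpM2r; first by rewrite exprn_ge0 // ltW.
  rewrite -!natrX -!natrM ler_nat.
  rewrite -(leq_pmul2r (fact_gt0 s)) mulnAC bin_ffact -[leqRHS]mulnA bin_ffact.
  by apply: leq_mul; [apply: leq_ffact_exp|apply: leq_exp_ffact].
rewrite [leRHS]mulrAC -exprMn; apply: ler_wpM2r => //.
apply: lerXn2r; rewrite ?nnegrE.
- by apply: mulr_ge0 => //; apply: ltW.
- by apply: mulr_ge0 => //; apply: divr_ge0.
by apply: le_trans Na _; rewrite div1r mulrC.
Qed.

Let bad := 2 * (2 * a / a1) ^+ s + s%:R * y ^+ k + 'C(N, s)%:R * a ^+ s / 'C(m', s)%:R.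

Let bad_ub : bad <= 4 / z%:R ^+ (Q + r + 3).
Proof.
have -> : 4 / z%:R ^+ (Q + r + 3) =
    2 / z%:R ^+ (Q + r + 3) + 1 / z%:R ^+ (Q + r + 3) + 1 / z%:R ^+ (Q + r + 3) :> R.
  by rewrite -!mulrDl; congr (_ / _); ring.
by rewrite !lerD // ?bad1 ?bad2 ?bad3.
Qed.

Let x := a * (1 - p) / (p * (1 - a)).

(** [x] is [2 ^- r] times [(1 - p) / (1 - a)], a ratio of at least [1 / 2] because [p <= 1 / 2]. *)
Let x_lb : x ^- M <= z%:R ^+ (r + 1).
Proof.
have ? := p0; have ? := p12; have ? := a0; have ? := a2p.
have rx : ((2 ^ (r + 1))%:R)^-1 <= x.
  have -> : x = (2 ^ r)%:R^-1 * ((1 - p) / (1 - a)).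
    have q0 : 1 - a != 0 by lra.
    by rewrite /x {1}/a; field; rewrite q0 !gt_eqF.
  rewrite expnD natrM invfM ler_wpM2l ?invr_ge0 // ler_pdivlMr; last by lra.
  by rewrite expn1; lra.
have -> : z%:R ^+ (r + 1) = (2 ^ (r + 1))%:R ^+ M :> R.
  by rewrite -!natrX /z -!expnM mulnC.
rewrite -exprVn; apply: lerXn2r; rewrite ?nnegrE ?invr_ge0 //.
  by apply: le_trans rx; rewrite invr_ge0.
have r1 : 0 < ((2 ^ (r + 1))%:R : R)^-1 by rewrite invr_gt0 ltr0n expn_gt0.
by rewrite -[leRHS]invrK lef_pV2 ?posrE // (lt_le_trans r1 rx).
Qed.

(** The noise loss [z ^ (r + 1)] turns [D_ub] into [1 / z <= 1 / M], whence the second copy of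
    [I / M]. The bad events leave a constant over [z ^ 2], at most [1 / Cv]. *)
Lemma variance_le_influence : (0 < Cv)%N ->
  expect p unsat - expect p unsat ^+ 2 <=
  2 * (p * (1 - p) * \sum_c expect p (ddiff c unsat)) / M%:R + 1 / Cv%:R.
Proof.
move=> Cv0; set I := p * (1 - p) * _.
have ? := p0; have ? := p12; have ? := a0; have ? := a2p; have ? := aa1.
have hp : 0 < p < 1 by lra.
have I0 : 0 <= I.
  rewrite mulr_ge0 ?mulr_ge0 ?subr_ge0 //; try lra.
  apply: sumr_ge0 => c _; apply: expect_ge0; first by lra.
  by move=> F; apply: diff_unsat_ge0.
have ap : a <= p by lra.
have a1b : 0 < a1 < 1 by have ? := a10; have ? := a1_12; lra.
have aa : 2 * a <= a1.
  by rewrite -[leRHS]mul1r -ler_pdivrMr //; have := aa1; lra.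
have [_ sm'] := m'_lb.
have := variance_unsat_le k0 M0 pE hp a0 ap b01 aa a1b half y1 sm' X0 X_lb km small.
move=> /le_trans; apply; rewrite -/x -/I -/D -/y -/bad.
have bad0 : 0 <= bad.
  have a1i : 0 <= a1^-1 by rewrite invr_ge0 ltW.
  have a0' := ltW a0.
  rewrite /bad; apply: addr_ge0; first apply: addr_ge0.
  - apply: mulr_ge0 => //; apply: exprn_ge0; apply: mulr_ge0 => //.
    exact: mulr_ge0.
  - by apply: mulr_ge0 => //; apply: exprn_ge0.
  - by apply: divr_ge0 => //; apply: mulr_ge0 => //; apply: exprn_ge0.
have zr0 : 0 <= z%:R ^+ (r + 1) :> R by rewrite exprn_ge0.
have pN : p * N%:R <= (2 ^ (k + 1 + Q))%:R * z%:R ^+ Q.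
  apply: (@le_trans _ _ ((2 ^ k.+1)%:R * n%:R)); first by rewrite -ler_pdivlMr.
  rewrite -natrX -!natrM ler_nat expnD addn1 -mulnA leq_mul2l.
  by apply/orP; right.
have zM : (z%:R)^-1 <= (M%:R)^-1 :> R by rewrite lef_pV2 ?posrE // ler_nat.
apply: (@le_trans _ _ (I / M%:R + z%:R ^+ (r + 1) *
  ((z%:R ^+ (r + 2))^-1 * I + (2 ^ (k + 1 + Q))%:R * z%:R ^+ Q *
   (4 / z%:R ^+ (Q + r + 3))))).
  rewrite lerD2l; apply: ler_pM x_lb _.
  - rewrite invr_ge0 exprn_ge0 // divr_ge0 // mulr_ge0 //; lra.
  - have D0 : 0 <= D.
      rewrite /D; apply: addr_ge0; first by have := b01; lra.
      by apply: mulr_ge0 => //; apply: addr_ge0; apply: divr_ge0.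
    apply: addr_ge0; first exact: mulr_ge0.
    by apply: mulr_ge0 => //; apply: mulr_ge0 => //; apply: ltW.
  - apply: lerD; first by apply: ler_wpM2r D_ub.
    by apply: ler_pM pN bad_ub => //; apply: mulr_ge0 => //; apply: ltW.
rewrite mulrDr addrA; apply: lerD.
  have -> : z%:R ^+ (r + 1) * ((z%:R ^+ (r + 2))^-1 * I) = I / z%:R.
    have -> : (r + 2 = (r + 1) + 1)%N by ring.
    rewrite (exprD _ (r + 1)) expr1 invfM -mulrA mulVKf; first by rewrite mulrC.
    by rewrite expf_neq0 // gt_eqF.
  have -> : 2 * I / M%:R = I / M%:R + I / M%:R by rewrite mulrDl mul1r mulrDl.
  by rewrite lerD2l; apply: ler_wpM2l.
have -> : z%:R ^+ (r + 1) * ((2 ^ (k + 1 + Q))%:R * z%:R ^+ Q * (4 / z%:R ^+ (Q + r + 3)))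
    = (2 ^ (k + Q + 3))%:R / z%:R ^+ 2 :> R.
  have -> : (2 ^ (k + Q + 3) = 2 ^ (k + 1 + Q) * 4)%N.
    by rewrite -[4%N]/(2 ^ 2)%N -expnD; congr (2 ^ _)%N; ring.
  have -> : (Q + r + 3 = Q + (r + 1) + 2)%N by ring.
  rewrite !(exprD _ _ 2) (exprD _ Q) natrM.
  have u0 : z%:R ^+ (r + 1) != 0 :> R by rewrite expf_neq0 // gt_eqF.
  have w0 : z%:R ^+ Q != 0 :> R by rewrite expf_neq0 // gt_eqF.
  have t0 : z%:R != 0 :> R by rewrite gt_eqF.
  move: (z%:R ^+ (r + 1)) (z%:R ^+ Q) u0 w0 => u w u0 w0.
  by field; rewrite t0 w0 u0.
rewrite ler_pdivrMr ?exprn_gt0 // mulrAC ler_pdivlMr ?ltr0n // mul1r.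
rewrite -natrX -natrM ler_nat mulnC (leq_trans z_Cv) //.
by rewrite -[X in (X <= _)%N]expn1 leq_pexp2l.
Qed.

End Density.
End LargeN.

(** * First moment bound for satisfiability *)

Section FirstMoment.
Variables (R : realFieldType) (n k : nat).
Local Notation clause := (clause n k).

Lemma leq_card_falsified (x : assignment n) :
  ('C(n, k) <= #|[set c : clause | falsifies x c]|)%N.
Proof.
rewrite -[X in 'C(X, _)](card_ord n) -card_draws.
apply: leq_trans (leq_imset_card (@vars n k) _); apply: subset_leq_card.
apply/subsetP => S; rewrite inE => /eqP Sk; have [c cE] := exists_clause x Sk.
apply/imsetP; exists c; last by apply/setP => i; rewrite inE cE; case: ifP.
by rewrite inE; apply/forallP => i; rewrite cE; case: ifP.
Qed.

(** Union bound over assignments: [x] satisfies [F] when [F] avoids the clauses falsified by [x], at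
    least one for each [k]-set. *)
Lemma expect_satisfiable_le (p : R) : 0 <= p <= 1 ->
  1 - expect p (@unsat R n k) <= (2 ^ n)%:R * (1 - p) ^+ 'C(n, k).
Proof.
move=> hp; have /andP[p0 p1] := hp.
pose A x := [set c : clause | falsifies x c].
have -> : 1 - expect p (@unsat R n k) =
    expect p (fun F : {set clause} => (satisfiable F)%:R).
  apply/eqP; rewrite subr_eq -expectD (expect_eq _ (g2 := fun=> 1)) ?expect_cst //.
  by move=> F; rewrite /unsat; case: (satisfiable F); rewrite /= ?addr0 ?add0r.
apply: (@le_trans _ _ (expect p (fun F : {set clause} =>
    \sum_x (F :&: A x == set0)%:R))).
  apply: ler_expect => // F; case: (boolP (satisfiable F)) => [/existsP[x xF]|_].
    rewrite (bigD1 x) //= (_ : F :&: A x == set0) ?lerDl ?sumr_ge0 //.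
    apply/eqP/setP => c; rewrite !inE; apply/negP => /andP[cF cx].
    by move/forall_inP: xF => /(_ c cF); rewrite cx.
  by rewrite sumr_ge0.
rewrite expect_sum.
apply: (@le_trans _ _ (\sum_(x : assignment n) (1 - p) ^+ 'C(n, k))).
  apply: ler_sum => x _; rewrite expect_setI ?sub0set // cards0 expr0 mul1r subn0.
  apply: ler_wiXn2l (leq_card_falsified x); first by rewrite subr_ge0.
  by rewrite lerBlDr lerDl.
by rewrite sumr_const card_ffun card_bool card_ord mulr_natl.
Qed.

End FirstMoment.

(** [2 ^ M] is [n ^ (1 / Q)] up to a factor of two, and the size conditions bound polynomials in [M]
    by [2 ^ M], true for large [M]. *)
Lemma influence_lower_bound (R : realFieldType) (k Cv : nat) :
  (3 <= k)%N -> (0 < Cv)%N ->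
  exists Q, exists M1, (0 < Q)%N /\ forall n (M := (trunc_log 2 n %/ Q)%N),
  (M1 <= M)%N -> forall p : R,
  n%:R / (#|{: clause n k}|%:R * M%:R) <= p ->
  p <= (2 ^ k.+1)%:R * n%:R / #|{: clause n k}|%:R ->
  expect p (@unsat R n k) - expect p (@unsat R n k) ^+ 2 <=
  2 * (p * (1 - p) * \sum_c expect p (ddiff c (@unsat R n k))) / M%:R + 1 / Cv%:R.
Proof.
move=> k3 Cv0; pose r := (3 * k + 4)%N; pose h := (r + 4)%N.
pose Q := (2 * (h * k + h + 1))%N; pose t := (Q + r + 3)%N.
pose K := (2 ^ k.+1 * k`!)%N.
have Q0 : (0 < Q)%N by rewrite /Q muln_gt0 /= addn1.
have [Ma ha] := exp2_dominates (1 + (1 + k * t) * (1 + 2 * 8 ^ k)) 1.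
have [Mb hb] := exp2_dominates (16 * k * (1 + k * t)) 1.
have [Mc hc] := exp2_dominates (2 * K) 0.
have [Md hd] := exp2_dominates (t.+1 * (K * (2 * t) ^ k) ^ 3) (1 + k * 3).
have [Me he] := exp2_dominates (Cv * 2 ^ (k + Q + 3)) 0.
exists Q, (1 + Ma + Mb + Mc + Md + Me)%N; split=> // n M hM p p_lb p_ub.
have M0 : (0 < M)%N by move: hM; clear; lia.
have Ma' : (Ma <= M)%N by move: hM; clear; lia.
have Mb' : (Mb <= M)%N by move: hM; clear; lia.
have Mc' : (Mc <= M)%N by move: hM; clear; lia.
have Md' : (Md <= M)%N by move: hM; clear; lia.
have Me' : (Me <= M)%N by move: hM; clear; lia.
have {Ma' ha} ha := ha M Ma'; have {Mb' hb} hb := hb M Mb'.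
have {Mc' hc} hc := hc M Mc'; have {Md' hd} hd := hd M Md'.
have {Me' he} he := he M Me'.
have lt0 : (0 < trunc_log 2 n)%N.
  by apply: leq_trans M0 _; apply: leq_div.
have n0 : (0 < n)%N by move: lt0; rewrite trunc_log_gt0 => /= /ltnW.
have zn : ((2 ^ M) ^ Q <= n)%N.
  rewrite -expnM; apply: leq_trans (@trunc_logP 2 n isT n0).
  by rewrite leq_pexp2l // leq_trunc_div.
have nz : (n <= 2 ^ Q * (2 ^ M) ^ Q)%N.
  rewrite -expnM -expnD; apply: leq_trans (ltnW (@trunc_log_ltn 2 n isT)) _.
  rewrite leq_pexp2l // -mulSn; exact: ltn_ceil.
(* As [M] is positive, constant terms are absorbed into multiples of [M]. *)
have aff A B : (A + B * M <= (A + B) * M)%N.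
  by rewrite mulnDl leq_add2r leq_pmulr.
apply: (@variance_le_influence R n k M Cv k3 M0 zn nz _ _ _ _ _ p p_lb p_ub
  (Ordinal n0) Cv0); rewrite -/r -/h -/Q -/t -/K.
- apply: (@leq_trans (2 ^ M)); last first.
    by rewrite -[X in (X <= _)%N]expn1 leq_pexp2l ?expn_gt0.
  apply: leq_trans ha; rewrite expn1.
  have -> : (1 + (1 + k * (t * M)) * (1 + 2 * 8 ^ k) =
      1 + (1 + 2 * 8 ^ k) + (k * t * (1 + 2 * 8 ^ k)) * M)%N by ring.
  apply: leq_trans (aff _ _) _; rewrite leq_mul2r; apply/orP; right.
  by rewrite mulnDl mul1n addnA.
- apply: leq_trans hb; rewrite expn1 -[leqRHS]mulnA leq_mul2l; apply/orP; right.
  have -> : (k * (t * M) = k * t * M)%N by ring.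
  exact: aff.
- by move: hc; rewrite expn0 muln1.
- apply: leq_trans hd.
  have -> : ((t * M).+1 * (K * (2 * (t * M)) ^ k) ^ 3 =
     (t * M).+1 * ((K * (2 * t) ^ k) ^ 3 * M ^ (k * 3)))%N.
    by rewrite [(2 * (t * M))%N]mulnA (expnMn (2 * t)) mulnA (expnMn _ (M ^ k)) -expnM.
  rewrite expnD expn1 [leqRHS]mulnACA; apply: leq_mul => //.
  by rewrite mulSn -add1n leq_add2r.
- by move: he; rewrite expn0 muln1.
Qed.

From mathcomp Require Import all_classical all_reals all_analysis.
Import Order.TTheory GRing.Theory Num.Theory numFieldNormedType.Exports.
Local Open Scope ring_scope.

(** * From total influence to the width of the window *)

Section Threshold.
Variables (R : realType) (n k : nat).
Local Notation N := #|{: clause n k}|.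
Local Notation unsat := (@unsat R n k).
Implicit Types p x y alpha : R.

Lemma mu_unsat p : mu p (unsat_event n k) = expect p unsat.
Proof.
rewrite /mu big_mkcond; apply: eq_bigr => F _.
by rewrite inE /unsat; case: (satisfiable F); rewrite /= ?mulr0 ?mulr1.
Qed.

Lemma expect_unsat_mvt x y : 0 <= x -> x < y -> y <= 1 ->
  exists2 z, x < z < y & expect y unsat - expect x unsat =
    (\sum_c expect z (ddiff c unsat)) * (y - x).
Proof.
move=> x0 xy y1; pose P := expect_poly unsat.
have [|z zxy] := @MVT R (horner P) (horner P^`()) x y xy
  (fun u _ => is_derive_poly P u).
  by apply: continuous_subspaceT => u; apply: continuous_horner.
rewrite !horner_expect_poly => E; exists z; first by rewrite in_itv /= in zxy.
move: zxy; rewrite in_itv /= => /andP[xz zy].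
by rewrite E russo // (le_lt_trans x0 xz) (lt_le_trans zy y1).
Qed.

Lemma expect_unsat_mono x y : 0 <= x -> x <= y -> y <= 1 ->
  expect x unsat <= expect y unsat.
Proof.
move=> x0; rewrite le_eqVlt => /predU1P[->//|xy] y1.
have [z /andP[xz zy]] := expect_unsat_mvt x0 xy y1; rewrite -subr_ge0 => ->.
rewrite mulr_ge0 ?subr_ge0 ?(ltW xy) //; apply: sumr_ge0 => c _.
apply: expect_ge0; first by rewrite (le_trans x0 (ltW xz)) (le_trans (ltW zy) y1).
by move=> F; apply: diff_unsat_ge0.
Qed.

Lemma p_alpha_le p alpha : 0 <= p <= 1 -> alpha <= expect p unsat ->
  p_alpha n k alpha <= p.
Proof.
move=> hp ha; apply: ge_inf; last by split; rewrite ?mu_unsat.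
by exists 0 => q [/andP[]].
Qed.

Lemma p_alpha_ge0 p alpha : 0 <= p <= 1 -> alpha <= expect p unsat ->
  0 <= p_alpha n k alpha.
Proof.
move=> hp ha; apply: lb_le_inf; last by move=> q [/andP[]].
by exists p; split; rewrite ?mu_unsat.
Qed.

(** The density [q] makes the set nonempty, so the infimum is genuine; some member lies below [p],
    and monotonicity concludes. *)
Lemma p_alpha_lt p q alpha : 0 <= q <= 1 -> alpha <= expect q unsat ->
  p_alpha n k alpha < p -> p <= 1 -> alpha <= expect p unsat.
Proof.
move=> hq ha + p1; have ne : ([set p : R | 0 <= p <= 1 /\
    alpha <= mu p (unsat_event n k)] !=set0)%classic.
  by exists q; split; rewrite ?mu_unsat.
move=> /(inf_lt ne)[r [/andP[r0 r1]]]; rewrite mu_unsat => ar rp.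
by apply: le_trans ar _; apply: expect_unsat_mono => //; apply: ltW.
Qed.

(* First moment: [2 ^ n * (1 - p) ^ 'C(n, k) <= exp (- n)]. *)
Lemma expect_unsat_ge eta p : 0 < eta -> eta^-1 <= n%:R -> 0 <= p <= 1 ->
  (2 ^ k.+1)%:R * n%:R / N%:R <= p -> (0 < 'C(n, k))%N ->
  1 - eta <= expect p unsat.
Proof.
move=> eta0 en hp pub C0; rewrite lerBlDr -lerBlDl.
apply: le_trans (expect_satisfiable_le n k hp) _.
have C0R : 0 < 'C(n, k)%:R :> R by rewrite ltr0n.
have pC : 2 * n%:R <= 'C(n, k)%:R * p.
  apply: le_trans (ler_wpM2l (ltW C0R) pub).
  rewrite card_clause /num_clauses expnS !natrM le_eqVlt; apply/orP; left; apply/eqP.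
  by field; rewrite !gt_eqF // ltr0n expn_gt0.
have /andP[_ p1] := hp.
apply: (@le_trans _ _ (expR n%:R * expR (- (2 * n%:R)))).
  apply: ler_pM; rewrite ?exprn_ge0 ?subr_ge0 //.
    rewrite natrX -[n%:R]mulr1 expRM_natl; apply: lerXn2r; rewrite ?nnegrE ?expR_ge0 //.
    by apply: le_trans (expR_ge1Dx _).
  apply: (@le_trans _ _ (expR (- p) ^+ 'C(n, k))).
    by apply: lerXn2r; rewrite ?nnegrE ?subr_ge0 ?expR_ge0 // expR_ge1Dx.
  by rewrite -expRM_natl mulrN ler_expR lerN2.
rewrite -expRD (_ : n%:R + _ = - n%:R); last by ring.
rewrite expRN invf_ple ?posrE ?expR_gt0 //; apply: le_trans en _.
by apply: le_trans (expR_ge1Dx _); rewrite lerDr.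
Qed.

(** Densities below [lo] cost at most [lo]. Above, the probability rises by at most one with slope
    at least [D]. *)
Lemma clause_window_le (eta lo hi D : R) : 0 < eta -> eta < 1 / 2 ->
  0 < lo -> 0 < hi -> hi <= 1 -> 0 < D -> 1 - eta <= expect hi unsat ->
  (forall p, lo < p < hi ->
     eta * (1 - eta) <= expect p unsat - expect p unsat ^+ 2 ->
     D <= \sum_c expect p (ddiff c unsat)) ->
  clause_window n k eta <= N%:R * (2 / D + lo).
Proof.
move=> eta0 eta12 lo0 hi0 hi1 D0 hihi infl.
rewrite /clause_window -card_clause; apply: ler_wpM2l => //.
set a := p_alpha n k eta; set b := p_alpha n k (1 - eta).
have hhi : 0 <= hi <= 1 by rewrite ltW.
have ehi : eta <= expect hi unsat by apply: le_trans hihi; lra.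
have a0 : 0 <= a := p_alpha_ge0 hhi ehi.
have bhi : b <= hi := p_alpha_le hhi hihi.
pose L := Num.max a lo.
have La : L <= a + lo by rewrite ge_max; apply/andP; split; lra.
have [bL|Lb] := leP b L.
  have D2 : 0 <= 2 / D by rewrite divr_ge0 // ltW.
  by lra.
have [aL loL] : a <= L /\ lo <= L by rewrite !le_max !lexx orbT.
(* The middle half of the interval stays strictly between the two infima, where the probability is
   in [[eta, 1 - eta]]; halving the length gives the [2] in [2 / D]. *)
pose x := L + (b - L) / 4; pose y := b - (b - L) / 4.
have xy : x < y by rewrite /x /y; lra.
have ax : a < x by rewrite /x; lra.
have lx : lo < x by rewrite /x; lra.
have yb : y < b by rewrite /y; lra.
have y1 : y <= 1 by lra.
have x0 : 0 <= x by lra.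
have ex : eta <= expect x unsat by apply: (p_alpha_lt hhi ehi ax); lra.
have ey : expect y unsat < 1 - eta.
  rewrite ltNge; apply/negP => h; have hy : 0 <= y <= 1 by lra.
  by have := le_lt_trans (p_alpha_le hy h) yb; rewrite ltxx.
have [z /andP[xz zy] E] := expect_unsat_mvt x0 xy y1.
have ez1 : eta <= expect z unsat.
  by apply: le_trans ex _; apply: expect_unsat_mono; lra.
have ez2 : expect z unsat <= 1 - eta.
  by apply: le_trans (ltW ey); apply: expect_unsat_mono; lra.
have Dz : D <= \sum_c expect z (ddiff c unsat).
  by apply: infl; [lra|nra].
have : D * (y - x) <= 1.
  apply: (@le_trans _ _ (expect y unsat - expect x unsat)); last lra.
  by rewrite E ler_wpM2r // subr_ge0 ltW.
rewrite -ler_pdivlMl // mulr1 => h.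
by rewrite /x /y in h; lra.
Qed.

End Threshold.

Theorem corollary7p10 (R : realType) (k : nat) (hk : (3 <= k)%N)
    (eta : R) (eta_gt0 : 0 < eta) (eta_lt : eta < 1 / 2) :
  exists C : R, exists n0 : nat, forall n : nat, (n0 <= n)%N ->
    clause_window n k eta <= C * (n%:R / ln n%:R).
Proof.
pose v0 := eta * (1 - eta).
have v00 : 0 < v0 by rewrite mulr_gt0 // subr_gt0; lra.
(* With this choice the error [1 / Cv] absorbs at most half of the variance bound [v0]. *)
pose Cv := Num.bound (2 / v0).
have Cv2 : 2 / v0 < Cv%:R by apply: archi_boundP; rewrite divr_ge0 // ltW.
have Cv0 : (0 < Cv)%N by rewrite -(ltr0n R) (lt_trans _ Cv2) // divr_gt0.
have [Q [M1 [Q0 infl]]] := influence_lower_bound R hk Cv0.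
pose A := 2 ^+ k.+1 : R.
(* The window is at most [(8 * A / v0 + 1) * n / M], and [ln n <= 2 * Q * M]. *)
exists ((8 * A / v0 + 1) * (2 * Q)%:R).
(* The terms ensure [M1 < M], [eta^-1 <= n], and, through the last two, [2 * n <= 'C(n, k)], so that
   [hi <= 1]. *)
exists (2 ^ (Q * M1.+1) + Num.bound eta^-1 + 2 * k + 16 * k`!)%N => n nn.
pose M := (trunc_log 2 n %/ Q)%N.
have n0 : (0 < n)%N.
  by apply: leq_trans nn; rewrite -!addnA addn_gt0 expn_gt0.
have M1M : (M1 < M)%N.
  rewrite leq_divRL // mulnC trunc_log_max //.
  by apply: leq_trans nn; rewrite -!addnA leq_addr.
have M0 : (0 < M)%N by apply: leq_ltn_trans M1M.
have nk : (2 * k <= n)%N by apply: leq_trans nn; rewrite -addnA addnCA leq_addr.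
have nf : (16 * k`! <= n)%N by apply: leq_trans nn; rewrite leq_addl.
have en : eta^-1 <= n%:R.
  have /ltW/le_trans : eta^-1 < (Num.bound eta^-1)%:R.
    by apply: archi_boundP; rewrite invr_ge0 ltW.
  apply; rewrite ler_nat; apply: leq_trans nn.
  by rewrite -!addnA addnCA leq_addr.
have Cn : (2 * n <= 'C(n, k))%N.
  rewrite -(leq_pmul2r (fact_gt0 k)) bin_ffact; apply: leq_trans (leq_exp_ffact n k).
  apply: (@leq_trans ((n - k) ^ 3)); last by rewrite leq_pexp2l //; move: nk hk; clear; lia.
  rewrite -(leq_pmul2l (_ : 0 < 8)%N) // -[8%N]/(2 ^ 3)%N -expnMn.
  apply: (@leq_trans (n ^ 3)); last by rewrite leq_exp2r //; move: nk; clear; lia.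
  rewrite expnS -mulnn; move: nf n0; move: (k`!) => f; clear; nia.
have C0 : (0 < 'C(n, k))%N by apply: leq_trans Cn; rewrite muln_gt0 n0.
have N0 : (0 < #|{: clause n k}|)%N by rewrite card_clause muln_gt0 expn_gt0 C0.
set N : R := #|{: clause n k}|%:R in infl *.
have NR : 0 < N by rewrite ltr0n.
have nR : 0 < n%:R :> R by rewrite ltr0n.
have MR : 0 < M%:R :> R by rewrite ltr0n.
have A0 : 0 < A by rewrite exprn_gt0.
(* At [hi] the first moment already gives unsatisfiability; below [lo] there are at most [n / M]
   expected clauses, within the target. *)
pose hi := A * n%:R / N; pose lo := n%:R / (N * M%:R).
have hi0 : 0 < hi by rewrite divr_gt0 ?mulr_gt0.
have lo0 : 0 < lo by rewrite divr_gt0 ?mulr_gt0.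
have AE : A = (2 ^ k.+1)%:R by rewrite natrX.
have hi1 : hi <= 1.
  rewrite ler_pdivrMr // mul1r AE -natrM ler_nat card_clause /num_clauses.
  by rewrite expnSr -mulnA leq_mul2l Cn orbT.
have hhi : 0 <= hi <= 1 by rewrite ltW.
have hihi : 1 - eta <= expect hi (@unsat R n k).
  by apply: expect_unsat_ge => //; rewrite /hi AE.
pose D := v0 * M%:R / (4 * hi).
have hi4 : 0 < 4 * hi by apply: mulr_gt0.
have D0 : 0 < D by apply: divr_gt0 => //; apply: mulr_gt0.
have inflD p : lo < p < hi ->
    v0 <= expect p (@unsat R n k) - expect p (@unsat R n k) ^+ 2 ->
    D <= \sum_c expect p (ddiff c (@unsat R n k)).
  move=> /andP[lop phi] v0p; set S := \sum_c _.
  have p0 : 0 < p := lt_trans lo0 lop.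
  have p1 : p <= 1 := le_trans (ltW phi) hi1.
  have S0 : 0 <= S.
    apply: sumr_ge0 => c _; apply: expect_ge0; first by rewrite (ltW p0).
    by move=> F; apply: diff_unsat_ge0.
  have := infl n (ltnW M1M) p (ltW lop); rewrite -AE => /(_ (ltW phi)).
  rewrite -/S -/M => /(le_trans v0p) v0S.
  have Cvv : 1 / Cv%:R <= v0 / 2.
    rewrite ler_pdivrMr ?ltr0n // mulrAC ler_pdivlMr // mul1r -ler_pdivrMl //.
    by rewrite mulrC ltW.
  have pS : p * (1 - p) * S <= hi * S.
    apply: ler_wpM2r => //; apply: le_trans (ltW phi).
    by rewrite ler_piMr ?(ltW p0) // gerBl ltW.
  have : v0 / 2 <= 2 * (hi * S) / M%:R.
    apply: (@le_trans _ _ (2 * (p * (1 - p) * S) / M%:R)).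
      by rewrite -(lerD2r (v0 / 2)) -splitr; apply: le_trans v0S _; rewrite lerD2l.
    by rewrite ler_wpM2r ?invr_ge0 ?(ltW MR) // ler_wpM2l.
  rewrite ler_pdivlMr // /D ler_pdivrMr // => h.
  have -> : v0 * M%:R = 2 * (v0 / 2 * M%:R) by field.
  have -> : S * (4 * hi) = 2 * (2 * (hi * S)) by ring.
  exact: ler_wpM2l.
apply: le_trans (clause_window_le eta_gt0 eta_lt lo0 hi0 hi1 D0 hihi inflD) _.
have -> : #|{: clause n k}|%:R * (2 / D + lo) = (8 * A / v0 + 1) * (n%:R / M%:R).
  by rewrite -/N /D /hi /lo; field; rewrite !gt_eqF.
rewrite -[leRHS]mulrA; apply: ler_wpM2l.
  by apply: addr_ge0 => //; apply: divr_ge0; rewrite ?(ltW v00) // mulr_ge0 ?(ltW A0).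
have n1 : 1 < n%:R :> R.
  rewrite ltr1n; apply: leq_trans nf; rewrite -[2%N]muln1.
  by apply: leq_mul => //; apply: fact_gt0.
have ln0 : 0 < ln n%:R :> R by apply: ln_gt0.
rewrite mulrCA; apply: ler_wpM2l; first exact: ltW.
rewrite -(ler_pM2r ln0) -mulrA mulVf ?gt_eqF // mulr1 mulrC ler_pdivrMr //.
(* [n] is below [2 ^ (Q * M.+1)] and [ln 2 <= 1], so [ln n <= Q * M.+1 <= 2 * Q * M]. *)
apply: (@le_trans _ _ (ln ((2 : R) ^+ (Q * M.+1)))).
  rewrite ler_ln ?posrE ?exprn_gt0 // -natrX ler_nat ltnW //.
  apply: leq_trans (@trunc_log_ltn 2 n isT) _.
  by rewrite leq_pexp2l // mulnC ltn_ceil.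
rewrite lnXn // -[ln 2 *+ _]mulr_natl; apply: (@le_trans _ _ ((Q * M.+1)%:R * 1)).
  apply: ler_wpM2l => //; have N11 : -1 < 1 :> R by lra.
  by have := le_ln1Dx N11; rewrite (_ : 1 + 1 = 2).
rewrite mulr1 -natrM ler_nat -mulnA mulnCA leq_mul2l; apply/orP; right.
by move: M0; clear; lia.
Qed.
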